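(* Let $H$ be a separable infinite dimensional complex Hilbert space, let $B(H)$ be the algebra of all bounded linear operators on $H$, and let ${}^{tr}$ denote the transpose with respect to an arbitrary but fixed complete orthonormal sequence in $H$. Let $\phi:B(H)\to B(H)$ be a linear bijection which preserves the partial isometries of infinite rank and infinite corank in both directions, i.e., for every $W\in B(H)$, $W$ is a partial isometry of infinite rank and infinite corank if and only if $\phi(W)$ is a partial isometry of infinite rank and infinite corank. Then there exist unitary operators $U,V\in B(H)$ such that either \[ \phi(T)=UTV \quad \text{for all } T\in B(H), \] or \[ \phi(T)=UT^{tr}V \quad \text{for all } T\in B(H). \]
   Context: An operator $W\in B(H)$ is a partial isometry if it is an isometry on a closed subspace of $H$ and $0$ on the orthogonal complement of that subspace; equivalently, $WW^*W=W$. An operator $A\in B(H)$ has infinite rank and infinite corank if the Hilbert space dimensions of $\overline{\operatorname{rng} A}$ and of $\overline{\operatorname{rng} A}^{\perp}$ are both infinite, where $\operatorname{rng} A$ is the range of $A$. The transpose of $T\in B(H)$ with respect to a complete orthonormal sequence $(e_n)$ in $H$ is the operator $T^{tr}\in B(H)$ determined by $\langle T^{tr}e_i,e_j\rangle=\langle Te_j,e_i\rangle$ for all $i,j$. *)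

(* Defs.v *)
From HB Require Import structures.
From mathcomp Require Import all_boot all_order all_algebra complex.
From mathcomp Require Import all_classical all_reals all_analysis.

Set Implicit Arguments.
Unset Strict Implicit.
Unset Printing Implicit Defensive.

Import Order.TTheory GRing.Theory Num.Theory.
Import numFieldNormedType.Exports.

Local Open Scope classical_set_scope.
Local Open Scope ring_scope.

(* The inner product is linear in its first argument and conjugate-linear in
   the second one. *)
HB.mixin Record CompleteNormedModule_isHilbert (R : realType) (H : Type)
    of CompleteNormedModule R[i] H := {
  hdot : {dot H for (@Num.conj R[i])} ;
  hdot_norm : forall x : H, hdot x x = `|x| ^+ 2
}.

#[short(type="hilbertType")]
HB.structure Definition Hilbert (R : realType) :=
  {H of CompleteNormedModule_isHilbert R H & CompleteNormedModule R[i] H}.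

Notation "''[' x , y ]" := (hdot x y) : ring_scope.

Section BoundedOperators.
Variables (R : realType) (H : hilbertType R).

(* The bound M is a complex number; since the order of R[i] only compares
   numbers with the same imaginary part, M * `|x| is real for every x. *)
Definition bounded_linear : {pred H -> H} :=
  [pred f | `[< linear f /\ exists M : R[i], forall x, `|f x| <= M * `|x| >]].

Record bop := Bop { bop_fun :> H -> H; _ : bop_fun \in bounded_linear }.

HB.instance Definition _ := [isSub for bop_fun].
HB.instance Definition _ := [Choice of bop by <:].

Lemma bounded_linearP (f : H -> H) :
  reflect (linear f /\ exists M : R[i], forall x, `|f x| <= M * `|x|)
          (f \in bounded_linear).
Proof. exact: asboolP. Qed.

Lemma bounded_linear_submod_closed : submod_closed bounded_linear.
Proof.
split=> [|a f g].
  apply/bounded_linearP; split=> [b x y|]; first by rewrite scaler0 addr0.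
  by exists 0 => x; rewrite normr0 mul0r.
move=> /bounded_linearP[fl [M Mf]] /bounded_linearP[gl [N Ng]].
have fgE x : (a *: f + g) x = a *: f x + g x by [].
apply/bounded_linearP; split=> [b x y|].
  by rewrite !fgE fl gl !scalerDr !scalerA [a * b]mulrC addrACA.
exists (`|a| * M + N) => x.
rewrite fgE (le_trans (ler_normD _ _)) // normrZ.
by rewrite mulrDl -mulrA lerD // ler_wpM2l.
Qed.

HB.instance Definition _ :=
  GRing.isSubmodClosed.Build _ _ bounded_linear bounded_linear_submod_closed.
HB.instance Definition _ := [SubChoice_isSubLmodule of bop by <:].

Lemma bop_is_linear (T : bop) : linear T.
Proof. by case/bounded_linearP: (valP T). Qed.

HB.instance Definition _ (T : bop) :=
  GRing.isLinear.Build R[i] H H *:%R T (bop_is_linear T).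

Lemma bopP (S T : bop) : S =1 T -> S = T.
Proof. by move=> ST; apply/val_inj/funext. Qed.

Lemma id_bounded_linear : idfun \in bounded_linear.
Proof.
by apply/bounded_linearP; split=> //; exists 1 => x; rewrite mul1r.
Qed.

Lemma comp_bounded_linear (S T : bop) : S \o T \in bounded_linear.
Proof.
have /bounded_linearP[_ [M SM]] := valP S.
have /bounded_linearP[_ [N TN]] := valP T.
apply/bounded_linearP; split=> [a x y|]; first by rewrite /= !linearP.
exists (`|M| * N) => x /=; apply: le_trans (SM _) _.
have /ger0_norm <- : 0 <= M * `|T x| by rewrite (le_trans _ (SM _)).
by rewrite normrM normr_id -mulrA ler_wpM2l.
Qed.

Definition bop_one := Bop id_bounded_linear.
Definition bop_mul (S T : bop) := Bop (comp_bounded_linear S T).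

Lemma bop_mulA : associative bop_mul. Proof. by move=> ? ? ?; exact/bopP. Qed.
Lemma bop_mul1l : left_id bop_one bop_mul. Proof. by move=> ?; exact/bopP. Qed.
Lemma bop_mul1r : right_id bop_one bop_mul. Proof. by move=> ?; exact/bopP. Qed.
Lemma bop_mulDl : left_distributive bop_mul +%R.
Proof. by move=> ? ? ?; exact/bopP. Qed.
Lemma bop_mulDr : right_distributive bop_mul +%R.
Proof. by move=> S ? ?; apply/bopP => x; exact: (linearD S). Qed.

HB.instance Definition _ := GRing.Zmodule_isPzRing.Build bop
  bop_mulA bop_mul1l bop_mul1r bop_mulDl bop_mulDr.

End BoundedOperators.

Section HilbertGeometry.
Variables (R : realType) (H : hilbertType R).
Implicit Types (A M B : set H).

Definition separable := exists2 D : set H, countable D & dense D.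

Definition orthocompl A : set H := [set x | forall y, A y -> '[x, y] = 0].

Definition closed_subspace M :=
  [/\ M 0, (forall (a : R[i]) x y, M x -> M y -> M (a *: x + y)) & closed M].

Definition orthonormal_set B :=
  forall x y, B x -> B y -> '[x, y] = (x == y)%:R.

(* Completeness is maximality: no nonzero vector of M is orthogonal to B. *)
Definition hilbert_basis M B :=
  [/\ B `<=` M, orthonormal_set B & M `&` orthocompl B `<=` [set 0]].

(* All Hilbert bases of a closed subspace have the same cardinality, so asking
   for one infinite basis is the same as asking for all of them. *)
Definition infinite_hilbert_dim M :=
  exists2 B, hilbert_basis M B & infinite_set B.

Definition complete_orthonormal_seq (e : nat -> H) :=
  (forall i j, '[e i, e j] = (i == j)%:R) /\
  (forall x, (forall n, '[x, e n] = 0) -> x = 0).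

End HilbertGeometry.

Arguments separable {R} H.

Section OperatorClasses.
Variables (R : realType) (H : hilbertType R).
Implicit Types (S T U W : bop H).

Definition is_adjoint T S := forall x y, '[T x, y] = '[x, S y].

Definition unitary U := exists2 S, is_adjoint U S & S * U = 1 /\ U * S = 1.

Definition partial_isometry W := exists M : set H,
  [/\ closed_subspace M, (forall x, M x -> `|W x| = `|x|)
    & (forall x, orthocompl M x -> W x = 0)].

Definition infinite_rank T := infinite_hilbert_dim (closure (range T)).

Definition infinite_corank T :=
  infinite_hilbert_dim (orthocompl (closure (range T))).

(* S is the transpose of T with respect to e; when e is a complete orthonormal
   sequence, every T has exactly one transpose. *)
Definition is_transpose (e : nat -> H) T S :=
  forall i j, '[S (e i), e j] = '[T (e j), e i].

Definition infinite_partial_isometry W :=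
  [/\ partial_isometry W, infinite_rank W & infinite_corank W].

End OperatorClasses.

(* Main.v *)
Require Import Defs.
From HB Require Import structures.
From mathcomp Require Import all_boot all_order all_algebra complex.
From mathcomp Require Import all_classical all_reals all_analysis.
From mathcomp Require Import ring.

Import Order.TTheory GRing.Theory Num.Theory.
Import numFieldNormedType.Exports.

Local Open Scope classical_set_scope.
Local Open Scope ring_scope.

Set Implicit Arguments.
Unset Strict Implicit.
Unset Printing Implicit Defensive.

(* Write P for the partial isometries of infinite rank and corank. If B and
   A + lB, for all |l| = 1, are partial isometries, then A is one too and is
   orthogonal to B (A B^* = A^* B = 0). Let Q be the class of all A such that
   A + lB is in P for some B in P and all |l| = 1; phi preserves Q, because Q is
   defined from P alone. The unit rank one operators are the nonzero elements of
   Q that are not orthogonal sums inside Q, so phi preserves operators of rank at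
   most one, in both directions.

   P is not closed under adjoints: it contains isometries, but no coisometries.
   This excludes the transposed form, and phi (x (x) y) = Cx (x) Dy with C and D
   unitary. If W in P is an isometry and |y| = 1, changing the value of W at y
   from Wy to l Wy gives again an element of P, and applying phi yields
   phi(W) Dy = CWy, i.e., phi(W) = C W D^*. Finally the isometries in P span
   B(H), without any continuity assumption on phi. *)

(** * Hilbert space preliminaries *)

Section InnerProduct.
Variables (R : realType) (H : hilbertType R).
Implicit Types (x y z : H) (a : R[i]).

Lemma hdotC x y : '[x, y] = '[y, x]^*.
Proof. by rewrite hermC expr0 mul1r. Qed.

Lemma hdotDl x y z : '[x + y, z] = '[x, z] + '[y, z].
Proof. exact: linearDl. Qed.

Lemma hdotDr x y z : '[x, y + z] = '[x, y] + '[x, z].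
Proof. exact: linearDr. Qed.

Lemma hdotZl a x y : '[a *: x, y] = a * '[x, y].
Proof. exact: linearZl_LR. Qed.

Lemma hdotZr a x y : '[x, a *: y] = a^* * '[x, y].
Proof. exact: linearZr_LR. Qed.

Lemma hdot0l x : '[0, x] = 0. Proof. exact: linear0l. Qed.
Lemma hdot0r x : '[x, 0] = 0. Proof. exact: linear0r. Qed.
Lemma hdotNl x y : '[- x, y] = - '[x, y]. Proof. exact: linearNl. Qed.
Lemma hdotNr x y : '[x, - y] = - '[x, y]. Proof. exact: linearNr. Qed.

Lemma hdotBl x y z : '[x - y, z] = '[x, z] - '[y, z].
Proof. exact: linearBl. Qed.

Lemma hdotBr x y z : '[x, y - z] = '[x, y] - '[x, z].
Proof. exact: linearBr. Qed.

Lemma hdot_suml I (r : seq I) (P : pred I) (F : I -> H) y :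
  '[\sum_(i <- r | P i) F i, y] = \sum_(i <- r | P i) '[F i, y].
Proof. exact: linear_sumlz. Qed.

Lemma hdot_sumr I (r : seq I) (P : pred I) (F : I -> H) x :
  '[x, \sum_(i <- r | P i) F i] = \sum_(i <- r | P i) '[x, F i].
Proof. exact: linear_sumr. Qed.

Lemma hdot_ge0 x : 0 <= '[x, x].
Proof. by rewrite hdot_norm exprn_ge0. Qed.

Lemma hdot_eq0 x : ('[x, x] == 0) = (x == 0).
Proof. by rewrite hdot_norm expf_eq0 normr_eq0. Qed.

Lemma hdot0_eq0 x : '[x, x] = 0 -> x = 0.
Proof. by move/eqP; rewrite hdot_eq0 => /eqP. Qed.

Lemma hdot_injl x y : (forall z, '[x, z] = '[y, z]) -> x = y.
Proof.
move=> xy; apply/subr0_eq/hdot0_eq0.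
by rewrite {1}(_ : x - y = x - y) // hdotBl xy subrr.
Qed.

Lemma hdot_injr x y : (forall z, '[z, x] = '[z, y]) -> x = y.
Proof. by move=> xy; apply: hdot_injl => z; rewrite hdotC xy -hdotC. Qed.

Lemma hdotDd x y : '[x, y] = 0 -> '[x + y, x + y] = '[x, x] + '[y, y].
Proof.
by move=> xy; rewrite hdotDl !hdotDr xy (hdotC y x) xy conjC0 addr0 add0r.
Qed.

Lemma CauchySchwarz_hdot x y : `|'[x, y]| <= `|x| * `|y|.
Proof.
have [->|y0] := eqVneq y 0; first by rewrite hdot0r !normr0 mulr0.
have yy0 : 0 < '[y, y] by rewrite dnorm_gt0.
rewrite -ler_sqr ?nnegrE ?mulr_ge0 // exprMn -!hdot_norm.
(* This vector is the part of [x] orthogonal to [y], scaled by ['[y, y]] to avoid a division. *)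
have := hdot_ge0 ('[y, y] *: x - '[x, y] *: y).
rewrite hdotBl !hdotBr !hdotZl !hdotZr.
rewrite (CrealP (ger0_real (hdot_ge0 y))) (hdotC y x) normCK.
rewrite (_ : _ - _ = '[y, y] * ('[x, x] * '[y, y] - '[x, y] * '[x, y]^*)).
  by rewrite pmulr_rge0 // subr_ge0.
ring.
Qed.

Lemma eq_hnorm x y : (`|x| == `|y|) = ('[x, x] == '[y, y]).
Proof. by rewrite !hdot_norm eqrXn2. Qed.

Lemma hnorm1P x : `|x| = 1 <-> '[x, x] = 1.
Proof.
rewrite hdot_norm; split=> [->|/eqP]; first by rewrite expr1n.
rewrite sqrf_eq1 => /orP[/eqP //|/eqP xN1].
by have := normr_ge0 x; rewrite xN1 oppr_ge0 ler10.
Qed.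

Lemma normalize x : x != 0 -> exists a, a != 0 /\ '[a *: x, a *: x] = 1.
Proof.
move=> x0; have nx0 : `|x| != 0 by rewrite normr_eq0.
exists `|x|^-1; split; first by rewrite invr_eq0.
by apply/hnorm1P; rewrite normrZ normfV normr_id mulVf.
Qed.

(** The defect [d] satisfies [a^* d + a d^* = 0] for every scalar [a]; the values 1 and i give
    [d = 0]. *)
Lemma polarization (f : H -> H) (M : set H) : linear f ->
  (forall a x y, M x -> M y -> M (a *: x + y)) ->
  (forall x, M x -> '[f x, f x] = '[x, x]) ->
  forall x y, M x -> M y -> '[f x, f y] = '[x, y].
Proof.
move=> fl Ml fi x y Mx My; set d := '[f x, f y] - '[x, y].
have dC : '[f y, f x] - '[y, x] = d^* by rewrite rmorphB /= -!hdotC.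
have E a : a^* * d + a * d^* = 0.
  have := fi (a *: y + x) (Ml _ _ _ My Mx).
  rewrite fl !(hdotDl, hdotDr, hdotZl, hdotZr) !fi // => E.
  rewrite -dC /d -(subrr (a * (a^* * '[y, y] + '[y, x]) +
    (a^* * '[x, y] + '[x, x]))) -{1}E; ring.
have := E 1; have := E 'i; rewrite conjC1 conjCi !mul1r mulNr => /eqP.
rewrite addrC subr_eq0 => /eqP/(mulfI (neq0Ci _)) -> /eqP.
by rewrite -mulr2n mulrn_eq0 /= subr_eq0 => /eqP.
Qed.

End InnerProduct.

(** * Convergence, the Riesz-Fischer theorem and Fourier expansions *)

Section Convergence.
Variables (R : realType) (H : hilbertType R).
Implicit Types (x y z : H) (a : R[i]).

Definition tends (s : nat -> H) (l : H) := forall eps : R[i], 0 < eps ->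
  exists N, forall n, (N <= n)%N -> `|l - s n| < eps.

Lemma tends_cauchy (s : nat -> H) :
  (forall eps : R[i], 0 < eps ->
    exists N, forall n, (N <= n)%N -> `|s N - s n| < eps) ->
  exists l, tends s l.
Proof.
move=> sC; have /cauchy_cvgP/cvg_ex[l sl] : cauchy (s @ \oo).
  apply: cauchy_exP => eps eps0; have [N sN] := sC _ eps0.
  exists (s N); exists N => // n Nn; rewrite -ball_normE /=; exact: sN.
exists l => eps eps0; move/cvgrPdist_lt: sl => /(_ _ eps0)[N _ sN].
by exists N => n Nn; exact: sN.
Qed.

Lemma norm_small_eq0 (V : normedZmodType R[i]) (v : V) (C : R[i]) : 0 <= C ->
  (forall eps : R[i], 0 < eps -> `|v| <= C * eps) -> v = 0.
Proof.
move=> C0 vC; apply/eqP; rewrite -normr_eq0; apply: contraT => v0.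
have v_gt0 : 0 < `|v| by rewrite lt_def v0 normr_ge0.
have C1 : 0 < C + 1 by rewrite ltr_wpDl.
have := vC (`|v| / (C + 1)) (divr_gt0 v_gt0 C1).
rewrite mulrA ler_pdivlMr // mulrC ler_pM2r // => C1C.
by have := le_lt_trans C1C (ltr_pwDr ltr01 (lexx C)); rewrite ltxx.
Qed.

Lemma tends_norm_le (s : nat -> H) l M :
  tends s l -> (forall n, `|s n| <= M) -> `|l| <= M.
Proof.
move=> sl sM; have M0 : 0 <= M := le_trans (normr_ge0 _) (sM 0%N).
have [//|Ml] := real_leP (ger0_real (normr_ge0 l)) (ger0_real M0).
have [N /(_ _ (leqnn N)) sN] : exists N, forall n, (N <= n)%N -> `|l - s n| < `|l| - M.
  by apply: sl; rewrite subr_gt0.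
have := ler_normD (l - s N) (s N); rewrite subrK => /le_lt_trans lN.
by have := lN _ (ltr_leD sN (sM N)); rewrite subrK ltxx.
Qed.

Lemma tends_hdotl (s : nat -> H) l y (c : R[i]) :
  tends s l -> (exists N, forall n, (N <= n)%N -> '[s n, y] = c) -> '[l, y] = c.
Proof.
move=> sl [N sc]; apply/subr0_eq/(norm_small_eq0 (normr_ge0 y)) => eps eps0.
have [N' sN'] := sl _ eps0.
rewrite -(sc (maxn N N')) ?leq_maxl // -hdotBl mulrC.
apply: le_trans (CauchySchwarz_hdot _ _) _.
by rewrite ler_wpM2r // ltW // sN' // leq_maxr.
Qed.

Lemma ge0_Re (c : R[i]) : 0 <= c -> c = (complex.Re c)%:C%C.
Proof. by move=> c0; rewrite RRe_real ?ger0_real. Qed.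

(** Suprema are taken in [R], through the real parts [v], which agree with [u] because [u] is
    nonnegative. *)
Lemma nondecreasing_bounded_cauchy (u : nat -> R[i]) M :
  {homo u : m n / (m <= n)%N >-> m <= n} -> (forall n, 0 <= u n <= M) ->
  forall eps, 0 < eps -> exists N, forall n, (N <= n)%N -> u n - u N < eps.
Proof.
move=> u_mono uM eps eps0; pose v n := complex.Re (u n).
have uv n : u n = (v n)%:C%C by apply: ge0_Re; case/andP: (uM n).
have M0 : 0 <= M by case/andP: (uM 0%N) => /le_trans; apply.
have v_sup : has_sup (range v).
  split; first by exists (v 0%N), 0%N.
  exists (complex.Re M) => _ [n _ <-]; rewrite -lecR -uv -(ge0_Re M0).
  by case/andP: (uM n).
have eps'0 : 0 < complex.Re eps by rewrite -ltcR -(ge0_Re (ltW eps0)).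
have [_ [N _ <-] vN] := sup_adherent eps'0 v_sup.
exists N => n Nn; rewrite !uv (ge0_Re (ltW eps0)) -rmorphB ltcR.
rewrite ltrBlDl -ltrBlDr; apply: le_lt_trans vN.
rewrite lerD2r; apply: ub_le_sup; first by case: v_sup.
by exists n.
Qed.

Variable e : nat -> H.
Hypothesis e_orth : forall i j, '[e i, e j] = (i == j)%:R.

Lemma orthonormal_sumE (c : nat -> R[i]) n k :
  '[\sum_(i < n) c i *: e i, e k] = if (k < n)%N then c k else 0.
Proof.
rewrite hdot_suml; under eq_bigr do rewrite hdotZl e_orth.
case: ltnP => kn.
  rewrite (bigD1 (Ordinal kn)) //= eqxx mulr1 big1 ?addr0 // => i.
  by rewrite -val_eqE /= => /negPf ->; rewrite mulr0.
rewrite big1 // => i _; rewrite (_ : _ == _ = false) ?mulr0 //.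
by apply: ltn_eqF; apply: leq_trans kn.
Qed.

Lemma orthonormal_sum_norm (c : nat -> R[i]) m n : (m <= n)%N ->
  `|\sum_(m <= i < n) c i *: e i| ^+ 2 = \sum_(m <= i < n) `|c i| ^+ 2.
Proof.
move=> mn; rewrite -hdot_norm; elim: n mn => [|n IHn].
  by rewrite leqn0 => /eqP ->; rewrite !big_nil hdot0l.
rewrite leq_eqVlt => /orP[/eqP ->|]; first by rewrite !big_geq // hdot0l.
rewrite ltnS => mn; rewrite !big_nat_recr //= hdotDd.
  by rewrite IHn // hdotZl hdotZr e_orth eqxx mulr1 normCK.
rewrite hdotZr hdot_suml big_nat big1 ?mulr0 // => i /andP[_ ltin].
by rewrite hdotZl e_orth (ltn_eqF ltin) mulr0.
Qed.

(** The partial sums are Cauchy because their squared norms increase and are bounded. The last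
    conclusion places [x] in the closed span of [e]: as [e] need not be complete here, the
    coefficients alone do not determine [x]. *)
Lemma riesz_fischer (c : nat -> R[i]) M :
  (forall n, \sum_(0 <= i < n) `|c i| ^+ 2 <= M ^+ 2) -> 0 <= M ->
  exists x, [/\ tends (fun n => \sum_(i < n) c i *: e i) x, `|x| <= M,
    forall n, '[x, e n] = c n
    & forall y, (forall n, '[e n, y] = 0) -> '[x, y] = 0].
Proof.
move=> cM M0; pose s n := \sum_(i < n) c i *: e i.
have sE n : s n = \sum_(0 <= i < n) c i *: e i by rewrite big_mkord.
have sB m n : (m <= n)%N -> s n - s m = \sum_(m <= i < n) c i *: e i.
  by move=> mn; rewrite !sE (big_cat_nat (leq0n m) mn) addrC addKr.
have [x sx] : exists x, tends s x.
  apply: tends_cauchy => eps eps0.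
  have [|||N sN] := @nondecreasing_bounded_cauchy
    (fun n => \sum_(0 <= i < n) `|c i| ^+ 2) (M ^+ 2) _ _ (eps ^+ 2).
  - move=> m n mn; rewrite [leRHS](big_cat_nat (leq0n m) mn) lerDl.
    by rewrite sumr_ge0 // => i _; rewrite exprn_ge0.
  - by move=> n; rewrite cM sumr_ge0 // => i _; rewrite exprn_ge0.
  - by rewrite exprn_gt0.
  exists N => n Nn; rewrite distrC sB // -ltr_sqr ?nnegrE //; last exact: ltW.
  rewrite orthonormal_sum_norm //; apply: le_lt_trans (sN n Nn).
  by rewrite (big_cat_nat (leq0n N) Nn) addrC addKr.
exists x; split => //.
- apply: (tends_norm_le sx) => n.
  by rewrite -ler_sqr ?nnegrE // sE orthonormal_sum_norm.
- move=> n; apply: (tends_hdotl sx); exists n.+1 => m nm.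
  by rewrite orthonormal_sumE nm.
- move=> y ye; apply: (tends_hdotl sx); exists 0%N => m _.
  by rewrite hdot_suml big1 // => i _; rewrite hdotZl ye mulr0.
Qed.

Lemma bessel x n : \sum_(0 <= i < n) `|'[x, e i]| ^+ 2 <= `|x| ^+ 2.
Proof.
pose s := \sum_(0 <= i < n) '[x, e i] *: e i.
have ss : '[s, s] = \sum_(0 <= i < n) `|'[x, e i]| ^+ 2.
  by rewrite hdot_norm orthonormal_sum_norm.
have xs : '[x, s] = '[s, s].
  rewrite ss hdot_sumr; apply: eq_bigr => i _.
  by rewrite hdotZr normCKC.
rewrite -ss -hdot_norm -subr_ge0.
have := hdot_ge0 (x - s); rewrite hdotBl !hdotBr xs (hdotC s x) xs.
by rewrite (CrealP (ger0_real (hdot_ge0 s))) subrr subr0.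
Qed.

Lemma fourier_sum_tends x : (forall y, (forall n, '[y, e n] = 0) -> y = 0) ->
  tends (fun n => \sum_(i < n) '[x, e i] *: e i) x.
Proof.
move=> e_total; have [y [sy _ ye _]] := riesz_fischer (bessel x) (normr_ge0 x).
suff xy : y = x by rewrite xy in sy.
by apply/subr0_eq/e_total => n; rewrite hdotBl ye subrr.
Qed.

End Convergence.

(** * Bounded operators and operators of rank at most one *)

Section Operators.
Variables (R : realType) (H : hilbertType R).
Implicit Types (x y z : H) (a : R[i]) (S T : bop H).

Lemma bop_ex (f : H -> H) (M : R[i]) : linear f ->
  (forall x, `|f x| <= M * `|x|) -> exists T : bop H, forall x, T x = f x.
Proof.
move=> fl fM; have f_bl : f \in @bounded_linear R H.
  by apply/bounded_linearP; split=> //; exists M.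
by exists (Bop f_bl).
Qed.

Lemma bop_bound T : exists2 M : R[i], 0 <= M & forall x, `|T x| <= M * `|x|.
Proof.
have /bounded_linearP[_ [M TM]] := valP T.
exists `|M| => // x; apply: le_trans (TM _) _.
have /ger0_norm <- : 0 <= M * `|x| by rewrite (le_trans _ (TM _)).
by rewrite normrM normr_id.
Qed.

Lemma bopDE S T x : (S + T) x = S x + T x. Proof. by []. Qed.
Lemma bopBE S T x : (S - T) x = S x - T x. Proof. by []. Qed.
Lemma bopNE T x : (- T) x = - T x. Proof. by []. Qed.
Lemma bopZE a T x : (a *: T) x = a *: T x. Proof. by []. Qed.
Lemma bopME S T x : (S * T) x = S (T x). Proof. by []. Qed.
Lemma bop0E x : (0 : bop H) x = 0. Proof. by []. Qed.
Lemma bop1E x : (1 : bop H) x = x. Proof. by []. Qed.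
Definition bopE := (bopDE, bopBE, bopNE, bopZE, bopME, bop0E, bop1E).

Lemma bop_funD T x y : T (x + y) = T x + T y. Proof. exact: linearD. Qed.
Lemma bop_funB T x y : T (x - y) = T x - T y. Proof. exact: linearB. Qed.
Lemma bop_funZ T a x : T (a *: x) = a *: T x. Proof. exact: linearZ. Qed.
Lemma bop_fun0 T : T 0 = 0. Proof. exact: linear0. Qed.

Lemma bop_scalerAl a S T : a *: (S * T) = (a *: S) * T.
Proof. exact: bopP. Qed.

Lemma bop_scalerAr a S T : a *: (S * T) = S * (a *: T).
Proof. by apply: bopP => x; rewrite !bopE linearZ. Qed.

Lemma tens_subproof x y : (fun z => '[z, y] *: x) \in @bounded_linear R H.
Proof.
apply/bounded_linearP; split=> [a u v|].
  by rewrite hdotDl hdotZl scalerDl scalerA.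
exists (`|x| * `|y|) => z; rewrite normrZ mulrC -mulrA ler_wpM2l //.
by rewrite mulrC CauchySchwarz_hdot.
Qed.

Definition tens x y : bop H := Bop (tens_subproof x y).

Lemma tensE x y z : tens x y z = '[z, y] *: x. Proof. by []. Qed.

Lemma tensDl x x' y : tens (x + x') y = tens x y + tens x' y.
Proof. by apply: bopP => z; rewrite !(tensE, bopE) scalerDr. Qed.

Lemma tensDr x y y' : tens x (y + y') = tens x y + tens x y'.
Proof. by apply: bopP => z; rewrite !(tensE, bopE) hdotDr scalerDl. Qed.

Lemma tensZl a x y : tens (a *: x) y = a *: tens x y.
Proof. by apply: bopP => z; rewrite !(tensE, bopE) !scalerA mulrC. Qed.

Lemma tensZr a x y : tens x (a *: y) = a^* *: tens x y.
Proof. by apply: bopP => z; rewrite !(tensE, bopE) hdotZr scalerA. Qed.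

Lemma tens0l y : tens 0 y = 0.
Proof. by apply: bopP => z; rewrite !(tensE, bopE) scaler0. Qed.

Lemma tens0r x : tens x 0 = 0.
Proof. by apply: bopP => z; rewrite !(tensE, bopE) hdot0r scale0r. Qed.

Lemma tensNl x y : tens (- x) y = - tens x y.
Proof. by rewrite -scaleN1r tensZl scaleN1r. Qed.

Lemma tensNr x y : tens x (- y) = - tens x y.
Proof. by rewrite -scaleN1r tensZr rmorphN rmorph1 scaleN1r. Qed.

Lemma mul_tens T x y : T * tens x y = tens (T x) y.
Proof. by apply: bopP => z; rewrite !(tensE, bopE) linearZ. Qed.

Lemma tensM x y u v : tens x y * tens u v = '[u, y] *: tens x v.
Proof. by rewrite mul_tens tensE tensZl. Qed.

Lemma tens_eq0 x y : (tens x y == 0) = (x == 0) || (y == 0).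
Proof.
apply/eqP/idP => [xy0|/orP[/eqP ->|/eqP ->]]; rewrite ?tens0l ?tens0r //.
have /eqP := congr1 (fun T : bop H => T y) xy0.
by rewrite tensE bop0E scaler_eq0 hdot_eq0 orbC.
Qed.

Lemma orthonormal_neq0 x : '[x, x] = 1 -> x != 0.
Proof. by move=> x1; rewrite -hdot_eq0 x1 oner_eq0. Qed.

(** Once a complete orthonormal sequence is given, [adjoint_ex] shows that the default 0 is never
    taken for lack of an adjoint. *)
Definition adj T : bop H := xget 0 [set S | is_adjoint T S].

End Operators.

Local Notation "T ^†" := (adj T) (at level 3, left associativity, format "T ^†").

(** * Adjoints and partial isometries *)

Section SeparableHilbertSpace.
Variables (R : realType) (H : hilbertType R).
Implicit Types (x y z : H) (a l : R[i]) (A B F S T W : bop H).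

Variable e : nat -> H.
Hypothesis e_complete : complete_orthonormal_seq e.

Let e_orth : forall i j, '[e i, e j] = (i == j)%:R := proj1 e_complete.
Let e_total : forall x, (forall n, '[x, e n] = 0) -> x = 0 := proj2 e_complete.

Lemma hdot_basis_inj x y : (forall n, '[x, e n] = '[y, e n]) -> x = y.
Proof.
by move=> xy; apply/subr0_eq/e_total => n; rewrite hdotBl xy subrr.
Qed.

Lemma bounded_form_eq0 (g : H -> R[i]) (M : R[i]) :
  0 <= M -> (forall a x y, g (a *: x + y) = a * g x + g y) ->
  (forall x, `|g x| <= M * `|x|) -> (forall n, g (e n) = 0) -> forall x, g x = 0.
Proof.
move=> M0 gl gM ge x; apply: (norm_small_eq0 M0) => eps eps0.
have [N /(_ _ (leqnn N)) xN] := fourier_sum_tends e_orth x e_total eps0.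
have gs n : g (\sum_(i < n) '[x, e i] *: e i) = 0.
  elim: n => [|n IHn]; last by rewrite big_ord_recr /= addrC gl IHn ge mulr0 addr0.
  rewrite big_ord0; have := gl (-1) 0 0.
  by rewrite scaler0 addr0 mulN1r addNr.
have := gl (-1) (\sum_(i < N) '[x, e i] *: e i) x.
rewrite gs mulr0 add0r scaleN1r addrC => <-.
by apply: le_trans (gM _) _; rewrite ler_wpM2l // ltW.
Qed.

(** [S y] is built from its coefficients ['[y, T (e n)]]. A partial sum [s] with these coefficients
    has [|s|^2 = '[y, T s] <= |y| M |s|], which is the bound that [riesz_fischer] requires. *)
Lemma adjoint_ex T : exists S, is_adjoint T S.
Proof.
have [M M0 TM] := bop_bound T.
have Sex y : exists x, `|x| <= M * `|y| /\ forall n, '[x, e n] = '[y, T (e n)].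
  have [||x [_ xM xe _]] := riesz_fischer e_orth
    (c := fun n => '[y, T (e n)]) (M := M * `|y|).
  - move=> n; set c := fun n => '[y, T (e n)].
    rewrite -(orthonormal_sum_norm e_orth c (leq0n n)).
    set s := \sum_(0 <= i < n) c i *: e i.
    have ss : `|s| ^+ 2 = '[y, T s].
      rewrite (orthonormal_sum_norm e_orth c (leq0n n)) linear_sum hdot_sumr.
      by apply: eq_bigr => i _; rewrite linearZ hdotZr normCKC.
    rewrite ler_sqr ?nnegrE ?mulr_ge0 //.
    have [->|s0] := eqVneq s 0; first by rewrite normr0 mulr_ge0.
    rewrite -(@ler_pM2r _ `|s|) ?normr_gt0 // -expr2 ss.
    rewrite -[leLHS]ger0_norm; last by rewrite -ss exprn_ge0.
    apply: le_trans (CauchySchwarz_hdot _ _) _.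
    by rewrite -mulrA mulrCA ler_wpM2l.
  - by rewrite mulr_ge0.
  by exists x.
have [f fP] := choice Sex.
have fl : linear f.
  move=> a x y; apply: hdot_basis_inj => n.
  rewrite hdotDl hdotZl !(proj2 (fP _)).
  by rewrite hdotDl hdotZl.
have [S SE] := bop_ex fl (fun y => proj1 (fP y)).
exists S => x y; apply/subr0_eq; move: x.
apply: (@bounded_form_eq0 (fun x => '[T x, y] - '[x, S y]) (M * `|y| + `|S y|)).
- by rewrite addr_ge0 ?mulr_ge0.
- move=> a x z; rewrite linearP !hdotDl !hdotZl; ring.
- move=> x; apply: le_trans (ler_normB _ _) _; rewrite mulrDl.
  apply: lerD; apply: le_trans (CauchySchwarz_hdot _ _) _.
    by rewrite mulrAC ler_wpM2r.
  by rewrite mulrC.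
- by move=> n; rewrite SE (hdotC (e n)) (proj2 (fP y)) -hdotC subrr.
Qed.

Lemma adjP T : is_adjoint T T^†.
Proof. by rewrite /adj; case: xgetP => // noS; have [S /noS] := adjoint_ex T. Qed.

Lemma adjE T x y : '[T x, y] = '[x, T^† y]. Proof. exact: adjP. Qed.

Lemma adjEr T x y : '[x, T y] = '[T^† x, y].
Proof. by rewrite hdotC adjE -hdotC. Qed.

Lemma adj_uniq T S : is_adjoint T S -> T^† = S.
Proof.
by move=> TS; apply: bopP => x; apply: hdot_injr => z; rewrite -adjE TS.
Qed.

Lemma adjK : involutive (@adj R H).
Proof. by move=> T; apply: adj_uniq => x y; rewrite -adjEr. Qed.

Lemma adjM S T : (S * T)^† = T^† * S^†.
Proof. by apply: adj_uniq => x y; rewrite !bopE !adjE. Qed.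

Lemma adjD S T : (S + T)^† = S^† + T^†.
Proof. by apply: adj_uniq => x y; rewrite !bopE hdotDl !adjE hdotDr. Qed.

Lemma adjN T : (- T)^† = - T^†.
Proof. by apply: adj_uniq => x y; rewrite !bopE hdotNl !adjE hdotNr. Qed.

Lemma adjB S T : (S - T)^† = S^† - T^†.
Proof. by rewrite adjD adjN. Qed.

Lemma adjZ a T : (a *: T)^† = a^* *: T^†.
Proof.
by apply: adj_uniq => x y; rewrite !bopE hdotZl !adjE hdotZr conjCK.
Qed.

Lemma adj1 : (1 : bop H)^† = 1.
Proof. by apply: adj_uniq => x y; rewrite !bopE. Qed.

Lemma adj0 : (0 : bop H)^† = 0.
Proof. by apply: adj_uniq => x y; rewrite !bopE hdot0l hdot0r. Qed.

Lemma adj_tens x y : (tens x y)^† = tens y x.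
Proof.
apply: adj_uniq => u v; rewrite !tensE hdotZl hdotZr (hdotC v x) conjCK.
by rewrite mulrC.
Qed.

Lemma tens_mul T x y : tens x y * T = tens x (T^† y).
Proof. by rewrite -[LHS]adjK adjM adj_tens mul_tens adj_tens. Qed.

Lemma bop_basis_inj S T : (forall n, S (e n) = T (e n)) -> S = T.
Proof.
move=> ST; rewrite -[S]adjK -[T]adjK; congr (_^†); apply: bopP => x.
by apply: hdot_basis_inj => n; rewrite -!adjEr ST.
Qed.

(** [W x] has along [v] the coefficients of [x] along [e]. Since [v] may be incomplete, [f_eq]
    identifies [f x] by its coefficients together with membership in the closed span of [v];
    linearity follows from this uniqueness. *)
Lemma isometry_ex (v : nat -> H) : (forall i j, '[v i, v j] = (i == j)%:R) ->
  exists W : bop H, W^† * W = 1 /\ forall n, W (e n) = v n.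
Proof.
move=> v_orth.
have Wex x : exists y, [/\ `|y| <= 1 * `|x|, forall n, '[y, v n] = '[x, e n]
    & forall z, (forall n, '[v n, z] = 0) -> '[y, z] = 0].
  have [y [_ yM yv yz]] :=
    riesz_fischer v_orth (bessel e_orth x) (normr_ge0 x).
  by exists y; rewrite mul1r.
have [f fP] := choice Wex.
have f_eq x y : (forall n, '[y, v n] = '[x, e n]) ->
    (forall z, (forall n, '[v n, z] = 0) -> '[y, z] = 0) -> f x = y.
  move=> yv yz; have [_ xv xz] := fP x.
  apply/subr0_eq/hdot0_eq0; set z := f x - y.
  have zv n : '[v n, z] = 0.
    by rewrite hdotBr (hdotC _ (f x)) (hdotC _ y) xv yv subrr.
  by rewrite {1}/z hdotBl xz // yz // subrr.
have fl : linear f.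
  move=> a x y; have [[_ xv xz] [_ yv yz]] := (fP x, fP y).
  apply: f_eq => [n|z vz].
    by rewrite !hdotDl !hdotZl xv yv.
  by rewrite hdotDl hdotZl xz // yz // mulr0 addr0.
have fM x : `|f x| <= 1 * `|x| by case: (fP x).
have [W WE] := bop_ex fl fM.
have We n : W (e n) = v n.
  by rewrite WE; apply: f_eq => [m|z]; rewrite ?v_orth ?e_orth.
exists W; split=> //; apply: bop_basis_inj => n; apply: hdot_basis_inj => m.
by rewrite !bopE -adjEr !We v_orth e_orth.
Qed.

Lemma bop_closed_eq0 T : closed [set x | T x = 0].
Proof.
have [M M0 TM] := bop_bound T.
move=> x xT; apply: (norm_small_eq0 M0) => eps eps0.
have [y [/= Ty0]] := xT _ (nbhsx_ballx x eps eps0).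
rewrite -ball_normE /= => xy.
rewrite -(subr0 (T x)) -Ty0 -linearB; apply: le_trans (TM _) _.
by rewrite ler_wpM2l // ltW.
Qed.

Lemma bop_neq0 T : T != 0 -> exists x, T x != 0.
Proof.
move=> T0; apply: contrapT => /forallNP Tx; case/eqP: T0.
by apply: bopP => x; apply/eqP; apply: contra_notT (Tx x).
Qed.

(** * Partial isometries of infinite rank and corank *)

Definition pisom T := T * T^† * T = T.

Lemma pisom_adj T : pisom T -> pisom T^†.
Proof. by move=> TT; rewrite /pisom adjK -[in RHS]TT !adjM adjK mulrA. Qed.

Lemma partial_isometryP T : partial_isometry T <-> pisom T.
Proof.
split=> [[M [[M0 Ml _] Ti Tk]]|TT].
  (* T^*Tm - m is orthogonal to both M and its orthocomplement, and x - T^*Tx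
     is orthogonal to M; so the projection theorem is not needed. *)
  have TtT m : M m -> T^† (T m) = m.
    move=> Mm; pose v := T^† (T m) - m.
    have vM m' : M m' -> '[v, m'] = 0.
      move=> Mm'; rewrite hdotBl -adjEr (polarization (bop_is_linear T) Ml) ?subrr //.
      by move=> x Mx; rewrite !hdot_norm Ti.
    apply/subr0_eq/hdot0_eq0; rewrite -/v {1}/v hdotBl -adjEr (Tk v) // hdot0r sub0r.
    by rewrite hdotC vM // conjC0 oppr0.
  rewrite /pisom; apply: bopP => x; rewrite !bopE; apply/esym/subr0_eq.
  rewrite -linearB; apply: Tk => m Mm.
  by rewrite hdotBl -adjEr adjE TtT // subrr.
(* Conversely, the initial space is the fixed space of [T^† * T], a kernel and hence closed. *)
exists [set x | (T^† * T - 1) x = 0]; split.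
- split; last exact: bop_closed_eq0.
    exact: (linear0 (T^† * T - 1)).
  by move=> a x y x0 y0; rewrite /mkset bop_is_linear x0 y0 scaler0 addr0.
- by move=> x /subr0_eq TTx; apply/eqP; rewrite eq_hnorm adjE -bopME TTx.
- move=> x xM; apply: hdot0_eq0; rewrite adjE xM ?hdot0r // /mkset.
  by rewrite !bopE -[T (T^† (T x))]/((T * T^† * T) x) TT subrr.
Qed.

(** Without the maximality of a Hilbert basis, the property passes to larger sets;
    [infinite_hilbert_dimP] recovers maximality. *)
Definition infdim (M : set H) :=
  exists B : set H, [/\ B `<=` M, orthonormal_set B & infinite_set B].

Lemma infdim_sub M N : M `<=` N -> infdim M -> infdim N.
Proof.
by move=> MN [B [BM Bo Bi]]; exists B; split=> //; exact: subset_trans MN.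
Qed.

Lemma infdim_seq (M : set H) (v : nat -> H) :
  (forall i j, '[v i, v j] = (i == j)%:R) -> (forall n, M (v n)) -> infdim M.
Proof.
move=> v_orth vM.
have v_inj : injective v.
  move=> i j vij; apply/eqP; have := v_orth i j.
  rewrite vij v_orth eqxx; case: (i == j) => // /eqP.
  by rewrite oner_eq0.
exists (range v); split.
- by move=> _ [n _ <-].
- by move=> _ _ [i _ <-] [j _ <-]; rewrite v_orth (inj_eq v_inj).
- move=> /(finite_preimage (f := v)) fin; apply: infinite_nat.
  by rewrite -(preimage_range v); apply: fin => i j _ _; exact: v_inj.
Qed.

Lemma infinite_hilbert_dimP (M : set H) :
  (forall a x, M x -> M (a *: x)) -> infinite_hilbert_dim M <-> infdim M.
Proof.
move=> Mz; split=> [[B [BM Bo _] Bi]|[B [BM Bo Bi]]]; first by exists B.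
(* Zorn's lemma extends [B]; joining [B] to [X] in the condition makes the union of the empty chain
   admissible. *)
pose P := [set X : set H | X `|` B `<=` M /\ orthonormal_set (X `|` B)].
have [F FP Ftot|A [[AM Ao] Amax]] := @Zorn_bigcup _ P.
  split=> [x [[X FX Xx]|/BM //]|x y].
    by have [XM _] := FP _ FX; apply: XM; left.
  move=> [[X FX Xx]|Bx] [[Y FY Yy]|By]; last exact: Bo.
  - have [XY|YX] := Ftot _ _ FX FY.
      by have [_ Yo] := FP _ FY; apply: Yo; left=> //; exact: XY.
    by have [_ Xo] := FP _ FX; apply: Xo; left=> //; exact: YX.
  - by have [_ Xo] := FP _ FX; apply: Xo; [left|right].
  - by have [_ Yo] := FP _ FY; apply: Yo; [right|left].
exists (A `|` B); last by apply: sub_infinite_set Bi => x; right.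
split=> // x [Mx xAB]; apply/eqP; apply: contraT => /normalize[a [a0 ax1]].
have Bax y : (A `|` B) y -> '[a *: x, y] = 0.
  by move=> ABy; rewrite hdotZl xAB ?mulr0.
case: (Amax (A `|` [set a *: x])); last first.
  split=> [y [[Ay|->]|By]|]; [by apply: AM; left|exact: Mz|exact: BM|].
  rewrite setUAC => y z [ABy|->] [ABz|->]; first exact: Ao.
  - rewrite hdotC Bax // conjC0; case: eqP => // yax.
    by move/eqP: ax1; rewrite -{1}yax hdotC Bax // conjC0 eq_sym oner_eq0.
  - rewrite Bax //; case: eqP => // yax.
    by move/eqP: ax1; rewrite {2}yax Bax // eq_sym oner_eq0.
  - by rewrite ax1 eqxx.
split; first by move=> y Ay; left.
move=> /(_ (a *: x) (or_intror erefl)) Aax; move/eqP: ax1.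
by rewrite Bax; [rewrite eq_sym oner_eq0|left].
Qed.

Lemma pisom_closure_range T : pisom T -> closure (range T) = range T.
Proof.
move=> TT; apply/seteqP; split; last exact: subset_closure.
have -> : range T = [set x | (T * T^† - 1) x = 0].
  apply/seteqP; split=> [_ [x _ <-]|x /subr0_eq TTx].
    by rewrite /mkset bopBE -bopME TT subrr.
  by exists (T^† x).
exact: bop_closed_eq0.
Qed.

Lemma orthocompl_range T : orthocompl (range T) = [set x | T^† x = 0].
Proof.
apply/seteqP; split=> [x xT|x /= Tx _ [y _ <-]].
  by apply: hdot_injl => y; rewrite -adjEr xT ?hdot0l //; exists y.
by rewrite adjEr Tx hdot0l.
Qed.

Lemma infinite_partial_isometryP W : infinite_partial_isometry W <->
  [/\ pisom W, infdim (range W) & infdim [set x | W^† x = 0]].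
Proof.
rewrite /infinite_partial_isometry /infinite_rank /infinite_corank.
suff WP : pisom W ->
    (infinite_hilbert_dim (closure (range W)) <-> infdim (range W)) /\
    (infinite_hilbert_dim (orthocompl (closure (range W))) <->
     infdim [set x | W^† x = 0]).
  split=> [[/partial_isometryP Wp Wr Wc]|[Wp Wr Wc]]; have [WPr WPc] := WP Wp.
    by split=> //; [exact/WPr|exact/WPc].
  by split; [exact/partial_isometryP|exact/WPr|exact/WPc].
move=> Wp; rewrite pisom_closure_range // orthocompl_range.
split; apply: infinite_hilbert_dimP => a x.
  by move=> [y _ <-]; exists (a *: y) => //; rewrite linearZ.
by rewrite /mkset => Wx; rewrite linearZ /= Wx scaler0.
Qed.

Local Notation pinf := (@infinite_partial_isometry R H).

Lemma pinf_pisom W : pinf W -> pisom W.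
Proof. by move/infinite_partial_isometryP => []. Qed.

(** The range of [A * S] contains that of [B], and the kernel of its adjoint contains that of [A^†]:
    infinite rank comes from [B], infinite corank from [A]. *)
Lemma pinf_factor A B S T : pinf A -> pinf B -> pisom (A * S) ->
  A * S * T = B -> pinf (A * S).
Proof.
move=> /infinite_partial_isometryP[_ _ Ac] /infinite_partial_isometryP[_ Br _].
move=> ASp AST; apply/infinite_partial_isometryP; split=> //.
  by apply: infdim_sub Br => _ [x _ <-]; exists (T x); rewrite // -AST.
by apply: infdim_sub Ac => x; rewrite /mkset adjM bopME => ->; rewrite linear0.
Qed.

Lemma isometry_pinf W : W^† * W = 1 -> infdim [set x | W^† x = 0] -> pinf W.
Proof.
move=> WW Wc; apply/infinite_partial_isometryP; split=> //.
  by rewrite /pisom -mulrA WW mulr1.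
apply: (infdim_seq (v := fun n => W (e n))) => [i j|n]; last by exists (e n).
by rewrite adjE -bopME WW e_orth.
Qed.

(** * Orthogonal sums of partial isometries *)

Lemma norm1_conj l : `|l| = 1 -> l * l^* = 1.
Proof. by move=> l1; rewrite -normCK l1 expr1n. Qed.

Lemma norm1_conjC l : `|l| = 1 -> l^* * l = 1.
Proof. by move=> l1; rewrite mulrC norm1_conj. Qed.

Lemma pisom_scale l T : `|l| = 1 -> pisom T -> pisom (l *: T).
Proof.
move=> l1 TT; rewrite /pisom adjZ -!(bop_scalerAl, bop_scalerAr) !scalerA TT.
by congr (_ *: _); have ll := norm1_conj l1; ring: ll.
Qed.

Lemma pisom_add A B : pisom A -> pisom B -> A * B^† = 0 -> A^† * B = 0 ->
  pisom (A + B).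
Proof.
move=> AA BB AB0 A0B.
have BA0 : B * A^† = 0 by rewrite -[LHS]adjK adjM adjK AB0 adj0.
rewrite /pisom adjD !(mulrDl, mulrDr) AB0 BA0 !(mul0r, add0r, addr0) AA BB.
have B0A : B^† * A = 0 by rewrite -[LHS]adjK adjM adjK A0B adj0.
by rewrite -!mulrA A0B B0A !mulr0 addr0 add0r.
Qed.

Lemma pisom_addZ A B l : pisom A -> pisom B -> A * B^† = 0 -> A^† * B = 0 ->
  `|l| = 1 -> pisom (A + l *: B).
Proof.
move=> AA BB AB0 A0B l1; apply: pisom_add => //; first exact: pisom_scale.
  by rewrite adjZ -bop_scalerAr AB0 scaler0.
by rewrite -bop_scalerAr A0B scaler0.
Qed.

Lemma sum_adj_mul_eq0 S T : S^† * S + T^† * T = 0 -> S = 0 /\ T = 0.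
Proof.
move=> ST0; suff ST x : S x = 0 /\ T x = 0.
  by split; apply: bopP => x; case: (ST x).
have /eqP : '[S x, S x] + '[T x, T x] = 0.
  by rewrite !(adjE _ x) -hdotDr -[_ + _]/((S^† * S + T^† * T) x) ST0 hdot0r.
by rewrite paddr_eq0 ?hdot_ge0 // !hdot_eq0 => /andP[/eqP ? /eqP ?].
Qed.

(** Sums over the fourth roots of unity, with weight 1 for [c0] and [l^*] for [c1], cancel the other
    powers of [l]. *)
Lemma circle_coefs (c0 c1 c2 c3 : R[i]) :
  (forall l, `|l| = 1 -> c0 + l * c1 + l^* * c2 + l ^+ 2 * c3 = 0) ->
  c0 = 0 /\ c1 = 0.
Proof.
pose f l := c0 + l * c1 + l^* * c2 + l ^+ 2 * c3; move=> E.
have [u [u1 uC u2]] : exists u : R[i], [/\ `|u| = 1, u^* = - u & u ^+ 2 = -1].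
  by exists 'i; rewrite normCi conjCi sqrCi.
have E1 : f 1 = 0 by apply: E; rewrite normr1.
have E2 : f (-1) = 0 by apply: E; rewrite normrN normr1.
have E3 : f u = 0 by apply: E.
have E4 : f (- u) = 0 by apply: E; rewrite normrN.
have n4 : 4 != 0 :> R[i] by rewrite pnatr_eq0.
split; apply: (mulfI n4); rewrite mulr0.
  transitivity (f 1 + f (-1) + (f u + f (- u))); last by rewrite E1 E2 E3 E4 !addr0.
  by rewrite /f !rmorphN /= conjC1 uC !sqrrN u2; ring.
transitivity (f 1 - f (-1) - u * (f u - f (- u))); last first.
  by rewrite E1 E2 E3 E4 !subrr mulr0 subrr.
by rewrite /f !rmorphN /= conjC1 uC !sqrrN u2; ring: u2.
Qed.

(* Comparing the coefficients of the powers of l in W W^* W = W for W = A + lB,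
   the coefficient of l gives (B^*B)(A^*A) + (A^*B)^*(A^*B) = 0; as B^*B is a
   projection, the first summand is self-adjoint, hence equal to
   (AB^*B)^*(AB^*B), and both summands vanish. *)
Lemma pisom_circle_orthogonal A B : pisom B ->
  (forall l, `|l| = 1 -> pisom (A + l *: B)) ->
  [/\ pisom A, A * B^† = 0 & A^† * B = 0].
Proof.
move=> BB AB.
have coefs x y :
    '[A (A^† (A x)) + A (B^† (B x)) + B (B^† (A x)) - A x, y] = 0 /\
    '[B (A^† (A x)) + A (A^† (B x)), y] = 0.
  have BBE u : B (B^† (B u)) = B u by rewrite -!bopME BB.
  have [|E0 E1] := @circle_coefs
    '[A (A^† (A x)) + A (B^† (B x)) + B (B^† (A x)) - A x, y]
    '[B (A^† (A x)) + A (A^† (B x)), y]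
    '[A (B^† (A x)), y] '[B (A^† (B x)), y].
    move=> l l1; have := congr1 (fun T : bop H => '[T x, y]) (AB l l1).
    rewrite adjD adjZ !(bopE, bop_funD, bop_funZ) BBE.
    move=> /eqP; rewrite -subr_eq0 => /eqP <-.
    rewrite !(hdotDl, hdotZl, hdotNl, scalerDr, scalerA).
    have ll := norm1_conj l1.
    ring: ll.
  by split.
have C0 : A * A^† * A + A * B^† * B + B * B^† * A - A = 0.
  apply: bopP => x; apply: hdot_injl => y.
  by rewrite hdot0l -(proj1 (coefs x y)).
have C1 : B * A^† * A + A * A^† * B = 0.
  apply: bopP => x; apply: hdot_injl => y.
  by rewrite hdot0l -(proj2 (coefs x y)).
pose E := B^† * B; pose P := A^† * A.
have EE : E * E = E by rewrite /E -!mulrA (mulrA B) BB.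
have EC : E^† = E by rewrite adjM adjK.
have PC : P^† = P by rewrite adjM adjK.
have NE : (A^† * B)^† * (A^† * B) = - (E * P).
  apply/eqP; rewrite eq_sym -subr_eq0 -opprD oppr_eq0; apply/eqP.
  by rewrite -[RHS](mulr0 B^†) -C1 mulrDr adjM adjK !mulrA.
have EPC : P * E = E * P.
  rewrite -[E * P]opprK -NE -[P * E]adjK adjM EC PC -[E * P]opprK -NE.
  by rewrite adjN adjM adjK.
have [AE0 AB0] : A * E = 0 /\ A^† * B = 0.
  apply: sum_adj_mul_eq0; rewrite NE adjM EC -mulrA (mulrA A^†) -/P EPC.
  by rewrite mulrA EE subrr.
have ABC : A * B^† = 0.
  have /= <- := pisom_adj BB.
  by rewrite adjK !mulrA -[A * B^† * B]mulrA AE0 mul0r.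
split=> //; move/subr0_eq: C0.
have BA0 : B^† * A = 0 by rewrite -[LHS]adjK adjM adjK AB0 adj0.
by rewrite ABC mul0r addr0 -[B * _ * A]mulrA BA0 mulr0 addr0.
Qed.

(** The isometries onto the closed spans of the even and of the odd basis vectors, generators of a
    Cuntz algebra. They split the space into two copies of itself, so one range leaves room for
    infinite corank. *)
Lemma shifts_ex : exists s1 s2 : bop H,
  [/\ s1^† * s1 = 1, s2^† * s2 = 1, s1^† * s2 = 0 & s1 * s1^† + s2 * s2^† = 1].
Proof.
have [i j|s1 [s11 s1e]] := isometry_ex (v := fun n => e n.*2).
  by rewrite e_orth (inj_eq double_inj).
have [i j|s2 [s22 s2e]] := isometry_ex (v := fun n => e n.*2.+1).
  by rewrite e_orth eqSS (inj_eq double_inj).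
have s12 : s1^† * s2 = 0.
  apply: bop_basis_inj => n; apply: hdot_basis_inj => m.
  rewrite bopME -adjEr s1e s2e e_orth bop0E hdot0l.
  by case: eqP => // /(congr1 odd); rewrite /= !odd_double.
have s21 : s2^† * s1 = 0 by rewrite -[LHS]adjK adjM adjK s12 adj0.
exists s1, s2; split=> //; apply: bop_basis_inj => n.
rewrite -[n]odd_double_half bopDE !bopME; case: (odd n); rewrite /= ?add0n ?add1n.
  rewrite -s2e -!bopME -(mulrA s2) -(mulrA s1) s12 s22 !bopE bop_fun0 add0r.
  by [].
by rewrite -s1e -!bopME -(mulrA s2) -(mulrA s1) s21 s11 !bopE bop_fun0 addr0.
Qed.

(* In each plane spanned by s1 (e n) and s2 (e n), pick a unit vector
   orthogonal to x. *)
Lemma isometry_avoid x : exists W, W^† * W = 1 /\ W^† x = 0.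
Proof.
have [s1 [s2 [s11 s22 s12 _]]] := shifts_ex.
have s21 : s2^† * s1 = 0 by rewrite -[LHS]adjK adjM adjK s12 adj0.
have dotE (c d c' d' : R[i]) n m :
    '[c *: s1 (e n) + d *: s2 (e n), c' *: s1 (e m) + d' *: s2 (e m)] =
    (c * c'^* + d * d'^*) * (n == m)%:R.
  rewrite hdotDl !hdotDr !hdotZl !hdotZr !adjE -!bopME s11 s12 s21 s22 !bopE.
  rewrite !hdot0r !e_orth; ring.
have vex n : exists cd : R[i] * R[i], cd.1 * cd.1^* + cd.2 * cd.2^* = 1 /\
    '[cd.1 *: s1 (e n) + cd.2 *: s2 (e n), x] = 0.
  pose p := '[s1 (e n), x]; pose q := '[s2 (e n), x].
  have [p0|p0] := eqVneq p 0.
    exists (1, 0); rewrite /= conjC1 mulr1 mul0r addr0 scale1r scale0r addr0.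
    by split.
  pose v := q *: s1 (e n) - p *: s2 (e n).
  have vE : v = q *: s1 (e n) + (- p) *: s2 (e n) by rewrite scaleNr.
  have v0 : v != 0.
    apply: contra_neq p0 => v0; have /eqP := dotE q (- p) q (- p) n n.
    rewrite -vE v0 hdot0l eqxx mulr1 eq_sym paddr_eq0 -?normCK ?exprn_ge0 //.
    by rewrite !expf_eq0 !normr_eq0 oppr_eq0 => /andP[_ /eqP].
  have [a [a0 av1]] := normalize v0; exists (a * q, a * - p) => /=.
  rewrite -!scalerA -scalerDr -vE; split.
    by have := av1; rewrite vE scalerDr !scalerA dotE eqxx mulr1.
  by rewrite hdotZl /v hdotBl !hdotZl -/p -/q mulrC [q * p]mulrC subrr mul0r.
have [c cP] := choice vex.
have [i j|W [WW We]] := isometry_ex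
  (v := fun n => (c n).1 *: s1 (e n) + (c n).2 *: s2 (e n)).
  rewrite dotE; have [<-|] := eqVneq i j; last by rewrite mulr0.
  by rewrite mulr1; case: (cP i).
exists W; split=> //; apply: hdot_basis_inj => n.
by rewrite -adjEr We hdotC (proj2 (cP n)) conjC0 hdot0l.
Qed.

(** * Rank one partial isometries and orthogonal summands *)

Lemma pisom_tens x y : '[x, x] * '[y, y] = 1 -> pisom (tens x y).
Proof.
move=> xy1; rewrite /pisom adj_tens !tensM -bop_scalerAl tensM scalerA.
by rewrite mulrC xy1 scale1r.
Qed.

Lemma pisom_tens_norm x y : pisom (tens x y) -> tens x y != 0 ->
  '[x, x] * '[y, y] = 1.
Proof.
rewrite /pisom adj_tens !tensM -bop_scalerAl tensM scalerA => xyp xy0.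
apply/eqP; rewrite -subr_eq0; move/eqP: xyp.
rewrite -subr_eq0 -{2}[tens x y]scale1r -scalerBl scaler_eq0 (negPf xy0) orbF.
by rewrite mulrC.
Qed.

(** The vector [z] is taken from an infinite orthonormal set in the kernel of [A^†]; the rest of
    that set still witnesses infinite corank. *)
Lemma pinf_add_tens A w : pinf A -> A w = 0 -> '[w, w] = 1 ->
  exists2 z, '[z, z] = 1 & forall l, `|l| = 1 -> pinf (A + l *: tens z w).
Proof.
move=> /infinite_partial_isometryP[Ap Ar [B [BA Bo Bi]]] Aw w1.
have [z Bz] := infinite_setN0 Bi.
have z1 : '[z, z] = 1 by rewrite Bo // eqxx.
have Az : A^† z = 0 := BA z Bz.
exists z => // l l1; apply/infinite_partial_isometryP; split.
- apply: pisom_addZ => //; first by apply: pisom_tens; rewrite z1 w1 mulr1.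
    by rewrite adj_tens mul_tens Aw tens0l.
  by rewrite mul_tens Az tens0l.
- apply: infdim_sub Ar => _ [x _ <-]; exists (A^† (A x)) => //.
  rewrite bopDE bopZE tensE -adjEr Aw hdot0r scale0r scaler0 addr0.
  by rewrite -!bopME Ap.
- exists (B `\ z); split; last exact: infinite_setD.
    move=> x [Bx /eqP xz]; rewrite /mkset adjD adjZ adj_tens bopDE bopZE tensE.
    by rewrite (BA _ Bx) Bo // (negPf xz) scale0r scaler0 addr0.
  by move=> x y [Bx _] [By _]; exact: Bo.
Qed.

(* Such an F is a partial isometry orthogonal to B, possibly of finite rank; the
   definition makes it visible to maps that are only known to preserve pinf. *)
Definition psummand F :=
  exists2 B, pinf B & forall l, `|l| = 1 -> pinf (F + l *: B).

Lemma psummand_orth F B : pinf B -> (forall l, `|l| = 1 -> pinf (F + l *: B)) ->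
  [/\ pisom F, F * B^† = 0 & F^† * B = 0].
Proof.
move=> Bp FB; apply: pisom_circle_orthogonal; first exact: pinf_pisom.
by move=> l l1; apply/pinf_pisom/FB.
Qed.

Lemma psummand_pisom F : psummand F -> pisom F.
Proof. by move=> [B Bp FB]; case: (psummand_orth Bp FB). Qed.

(** The first equation says that [F * S] vanishes off the initial space of [F], so [F * S] stays
    orthogonal to the same witness [B]. *)
Lemma psummand_mulr F S : psummand F -> F * S * F^† * F = F * S ->
  pisom (F * S) -> psummand (F * S).
Proof.
move=> [B Bp FB] FS FSp; have [Fp FB0 F0B] := psummand_orth Bp FB.
have BF0 : B * F^† = 0 by rewrite -[LHS]adjK adjM adjK FB0 adj0.
have Bpp := pinf_pisom Bp.
have FSB0 : F * S * B^† = 0.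
  by rewrite -FS -[_ * F * _]mulrA FB0 mulr0.
have F0SB : (F * S)^† * B = 0 by rewrite adjM -mulrA F0B mulr0.
exists B => // l l1.
(* As a right multiple of [F + l *: B], this operator inherits infinite corank; its product with
   [l^* *: (B^† * B)] is [B], which gives infinite rank. *)
have FSE : F * S + l *: B = (F + l *: B) * (F^† * F * S + B^† * B).
  rewrite mulrDl !mulrDr -!bop_scalerAl !mulrA Fp FB0 BF0 Bpp !mul0r scaler0.
  by rewrite addr0 add0r.
have := pisom_addZ FSp Bpp FSB0 F0SB l1; rewrite FSE => FSEp.
apply: (pinf_factor (T := l^* *: (B^† * B)) (FB l l1) Bp FSEp).
rewrite -FSE mulrDl -!bop_scalerAr -bop_scalerAl !mulrA FSB0 Bpp mul0r scaler0.
by rewrite add0r scalerA norm1_conjC // scale1r.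
Qed.

(** The witness is [B = X * s1 * Y^†], where the isometries [X] and [Y] have ranges orthogonal to
    [x] and [y]. The vectors [X (s2 (e n))] are orthogonal to [x] and to the range of [B], and
    provide infinite corank. *)
Lemma psummand_tens x y : '[x, x] = 1 -> '[y, y] = 1 -> psummand (tens x y).
Proof.
move=> x1 y1; have [s1 [s2 [s11 s22 s12 _]]] := shifts_ex.
have [X [XX Xx]] := isometry_avoid x; have [Y [YY Yy]] := isometry_avoid y.
pose B := X * s1 * Y^†.
have BY : B * Y = X * s1 by rewrite /B -mulrA YY mulr1.
have By : B y = 0 by rewrite /B bopME Yy bop_fun0.
have BC : B^† = Y * s1^† * X^† by rewrite /B !adjM adjK mulrA.
have Bx : B^† x = 0 by rewrite BC bopME Xx bop_fun0.
have Bp : pisom B.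
  have BB : B^† * B = Y * Y^†.
    by rewrite BC /B !mulrA -(mulrA _ X^†) XX mulr1 -(mulrA _ s1^†) s11 mulr1.
  by rewrite /pisom -mulrA BB mulrA BY.
have xyp : pisom (tens x y) by apply: pisom_tens; rewrite x1 y1 mulr1.
have xyB : tens x y * B^† = 0 by rewrite tens_mul adjK By tens0r.
have xy0B : (tens x y)^† * B = 0 by rewrite adj_tens tens_mul Bx tens0r.
have orth T : T^† * T = 1 -> forall i j, '[T (e i), T (e j)] = (i == j)%:R.
  by move=> TT i j; rewrite adjE -bopME TT bop1E e_orth.
have Bc n : B^† (X (s2 (e n))) = 0.
  by rewrite BC -!bopME -!mulrA (mulrA X^†) XX mul1r s12 mulr0.
have Xs2 : (X * s2)^† * (X * s2) = 1.
  by rewrite adjM -mulrA (mulrA X^†) XX mul1r s22.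
have Xs1 : (X * s1)^† * (X * s1) = 1.
  by rewrite adjM -mulrA (mulrA X^†) XX mul1r s11.
exists B => [|l l1]; apply/infinite_partial_isometryP; split=> //.
- apply: (infdim_seq (orth _ Xs1)) => n; exists (Y (e n)) => //.
  by rewrite -bopME BY.
- exact: (infdim_seq (orth _ Xs2)).
- exact: pisom_addZ.
- apply: (infdim_seq (orth _ Xs1)) => n; exists (l^* *: Y (e n)) => //.
  rewrite bop_funZ bopDE bopZE -[B (Y _)]bopME BY tensE adjE Yy hdot0r scale0r add0r.
  by rewrite scalerA norm1_conjC // scale1r.
- apply: (infdim_seq (orth _ Xs2)) => n.
  rewrite /mkset adjD adjZ adj_tens bopDE bopZE tensE Bc scaler0 addr0.
  by rewrite bopME adjE Xx hdot0r scale0r.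
Qed.

(** [F] is split along a unit vector [y] of its initial space into [F * p = tens (F y) y] and
    [F2 = F * (1 - p)]. If [F2 = 0], then [F] has rank one; otherwise [psummand_mulr] applies to
    both parts and to [F * (p + l *: (1 - p))]. *)
Lemma psummand_split F : psummand F -> F != 0 ->
  (exists x y, [/\ '[x, x] = 1, '[y, y] = 1 & F = tens x y]) \/
  (exists F1 F2, [/\ F1 != 0, F2 != 0, F = F1 + F2, psummand F1 &
     psummand F2 /\ forall l, `|l| = 1 -> psummand (F1 + l *: F2)]).
Proof.
move=> Fs /bop_neq0[x0 Fx0]; have Fp := psummand_pisom Fs.
have [y [y1 FFy]] : exists y, '[y, y] = 1 /\ F^† (F y) = y.
  have y0 : F^† (F x0) != 0.
    by apply: contra_neq Fx0 => FFx0; rewrite -Fp !bopE FFx0 bop_fun0.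
  have [a [_ ay]] := normalize y0; exists (a *: F^† (F x0)); split=> //.
  by rewrite !bop_funZ -[F (F^† (F x0))]/((F * F^† * F) x0) Fp.
pose p := tens y y; pose F2 := F - tens (F y) y.
have Fy1 : '[F y, F y] = 1 by rewrite adjE FFy.
have [F20|F20] := eqVneq F2 0.
  by left; exists (F y), y; split=> //; apply: subr0_eq.
right; exists (tens (F y) y), F2.
have F1p : pisom (tens (F y) y) by apply: pisom_tens; rewrite Fy1 y1 mulr1.
have pF : tens (F y) y * F^† * F = tens (F y) y.
  by rewrite !tens_mul adjK FFy.
have F2F : F2 * F^† * F = F2 by rewrite !mulrBl Fp pF.
have F12 : tens (F y) y * F2^† = 0.
  by rewrite adjB adj_tens mulrBr tens_mul adjK tensM y1 scale1r subrr.
have F0 : (tens (F y) y)^† * F2 = 0.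
  by rewrite adj_tens mulrBr tens_mul FFy tensM Fy1 scale1r subrr.
have F2p : pisom F2.
  have F2y : F2 y = 0 by rewrite bopBE tensE y1 scale1r subrr.
  rewrite /pisom -mulrA; have -> : F2^† * F2 = F^† * F2.
    by rewrite {1}/F2 adjB mulrBl F0 subr0.
  by rewrite mulrA {2}/F2 mulrBr F2F mul_tens bopME FFy F2y tens0l subr0.
have FpE : F * p = tens (F y) y by rewrite mul_tens.
have Fp'E : F * (1 - p) = F2 by rewrite mulrBr mulr1 FpE.
have FlE l : F * (p + l *: (1 - p)) = tens (F y) y + l *: F2.
  by rewrite mulrDr -bop_scalerAr FpE Fp'E.
split; [|done| |  |].
- by rewrite tens_eq0 negb_or !orthonormal_neq0.
- by rewrite addrC subrK.
- by rewrite -FpE; apply: psummand_mulr; rewrite ?FpE.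
split; first by rewrite -Fp'E; apply: psummand_mulr; rewrite ?Fp'E.
move=> l l1; rewrite -FlE; apply: psummand_mulr; rewrite ?FlE //.
  by rewrite !mulrDl pF -!bop_scalerAl F2F.
exact: pisom_addZ.
Qed.

(** The condition on [F1 + l *: F2] makes the summands orthogonal, so each [Fi] equals
    [tens x y * Fi^† * Fi] and has its range in the line of [x]; orthogonal ranges in one line force
    a summand to vanish. *)
Lemma tens_indecomposable x y F1 F2 : tens x y = F1 + F2 -> psummand F1 ->
  psummand F2 -> (forall l, `|l| = 1 -> psummand (F1 + l *: F2)) ->
  F1 = 0 \/ F2 = 0.
Proof.
move=> xyE F1s F2s F12s.
have [F1p F12 F012] : [/\ pisom F1, F1 * F2^† = 0 & F1^† * F2 = 0].
  apply: pisom_circle_orthogonal; first exact: psummand_pisom.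
  by move=> l l1; apply/psummand_pisom/F12s.
have F21 : F2 * F1^† = 0 by rewrite -[LHS]adjK adjM adjK F12 adj0.
have F1E : F1 = tens x (F1^† (F1 y)).
  have : tens x y * F1^† * F1 = F1 by rewrite xyE !mulrDl F21 mul0r addr0.
  by rewrite !tens_mul adjK.
have F2E : F2 = tens x (F2^† (F2 y)).
  have : tens x y * F2^† * F2 = F2.
    by rewrite xyE !mulrDl F12 mul0r add0r; apply: psummand_pisom.
  by rewrite !tens_mul adjK.
move: F012; rewrite {1}F1E F2E adj_tens tensM => /eqP.
rewrite scaler_eq0 hdot_eq0 tens_eq0 => /orP[/eqP x0|/orP[]/eqP z0].
- by left; rewrite F1E x0 tens0l.
- by left; rewrite F1E z0 tens0r.
- by right; rewrite z0 tens0r.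
Qed.

(** * The span of the isometries *)

Definition opbound (c : R[i]) T := forall x, `|T x| <= c * `|x|.

Lemma opbound_le c d T : c <= d -> opbound c T -> opbound d T.
Proof. by move=> cd cT x; apply: le_trans (cT x) _; rewrite ler_wpM2r. Qed.

Lemma opboundD c d S T : opbound c S -> opbound d T -> opbound (c + d) (S + T).
Proof.
by move=> cS dT x; rewrite bopDE mulrDl (le_trans (ler_normD _ _)) ?lerD.
Qed.

Lemma opboundN c T : opbound c T -> opbound c (- T).
Proof. by move=> cT x; rewrite bopNE normrN. Qed.

Lemma opboundB c d S T : opbound c S -> opbound d T -> opbound (c + d) (S - T).
Proof. by move=> cS dT; apply: opboundD => //; exact: opboundN. Qed.

Lemma opboundM c d S T : 0 <= c -> opbound c S -> opbound d T ->
  opbound (c * d) (S * T).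
Proof.
move=> c0 cS dT x; rewrite bopME (le_trans (cS _)) // -mulrA.
by rewrite ler_wpM2l.
Qed.

Lemma opboundZ a c T : opbound c T -> opbound (`|a| * c) (a *: T).
Proof. by move=> cT x; rewrite bopZE normrZ -mulrA ler_wpM2l. Qed.

Lemma pow2_small (eps : R[i]) : 0 < eps -> exists n, 2^-1 ^+ n < eps.
Proof.
move=> eps0; have epsE := ge0_Re (ltW eps0); set r := complex.Re eps in epsE.
have r0 : 0 < r by rewrite -ltcR -epsE.
pose n := Num.bound r^-1; exists n.
have rn : r^-1 < n%:R by apply: archi_boundP; rewrite invr_ge0 ltW.
rewrite epsE exprVn -[2]/(2%:R) -natrX -(rmorph_nat (real_complex R)) -fmorphV /=.
rewrite ltcR -(invrK r) ltf_pV2 ?posrE ?invr_gt0 ?ltr0n ?expn_gt0 //.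
by apply: lt_le_trans rn _; rewrite ler_nat ltnW // ltn_expl.
Qed.

Lemma pow2_small_eq0 (V : normedZmodType R[i]) (v : V) (c : R[i]) : 0 <= c ->
  (forall n, `|v| <= c * 2^-1 ^+ n) -> v = 0.
Proof.
move=> c0 vc; apply: (norm_small_eq0 c0) => eps /pow2_small[n neps].
by apply: le_trans (vc n) _; rewrite ler_wpM2l // ltW.
Qed.

Lemma opbound_pow2_eq0 T (c : R[i]) : 0 <= c ->
  (forall n, opbound (c * 2^-1 ^+ n) T) -> T = 0.
Proof.
move=> c0 cT; apply: bopP => x; apply: (@pow2_small_eq0 _ _ (c * `|x|)).
  by rewrite mulr_ge0.
by move=> n; rewrite mulrAC; exact: cT.
Qed.

(** Completeness with an explicit rate: the tail of the geometric series from [n] on is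
    [2 * 2^-1 ^+ n]. *)
Lemma bop_limit (Z : nat -> bop H) :
  (forall n, opbound (2^-1 ^+ n) (Z n.+1 - Z n)) ->
  exists L, forall n, opbound (2 * 2^-1 ^+ n) (L - Z n).
Proof.
move=> Zc.
have Zd n k x : `|Z (n + k)%N x - Z n x| <= 2 * 2^-1 ^+ n * `|x|.
  (* Subtracting the remaining tail makes the bound telescope in the induction on [k]. *)
  suff : `|Z (n + k)%N x - Z n x| <= (2 * 2^-1 ^+ n - 2 * 2^-1 ^+ (n + k)) * `|x|.
    by move=> /le_trans; apply; rewrite ler_wpM2r // gerBl mulr_ge0 // ltW.
  elim: k => [|k IHk]; first by rewrite addn0 !subrr normr0 mul0r.
  rewrite addnS -(subrK (Z (n + k)%N x) (Z _ x)) -addrA.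
  apply: le_trans (ler_normD _ _) _.
  have -> : 2 * 2^-1 ^+ n - 2 * 2^-1 ^+ (n + k).+1 =
      2^-1 ^+ (n + k) + (2 * 2^-1 ^+ n - 2 * 2^-1 ^+ (n + k)) :> R[i].
    by rewrite [_ ^+ _.+1]exprS; field.
  by rewrite mulrDl lerD // -bopBE; exact: Zc.
have lim_ex x : exists y, forall n, `|y - Z n x| <= 2 * 2^-1 ^+ n * `|x|.
  have [eps eps0|y yP] := @tends_cauchy R H (fun n => Z n x).
    have [N Neps] : exists N, 2^-1 ^+ N < eps / (2 * (`|x| + 1)).
      by apply: pow2_small; rewrite divr_gt0 // mulr_gt0 // ltr_wpDl.
    exists N => n Nn; rewrite distrC -(subnKC Nn); apply: le_lt_trans (Zd _ _ _) _.
    move: Neps; rewrite ltr_pdivlMr ?mulr_gt0 ?ltr_wpDl //; apply: le_lt_trans.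
    by rewrite [2 * _]mulrC -mulrA !ler_pM2l // lerDl.
  exists y => n; apply: (@tends_norm_le _ _ (fun k => Z (n + k)%N x - Z n x)).
    move=> eps /yP[N yN]; exists N => k Nk.
    by rewrite opprB addrA subrK; apply: yN; rewrite (leq_trans Nk) ?leq_addl.
  by move=> k; exact: Zd.
have [f fP] := choice lim_ex.
have fl : linear f.
  move=> a x y; apply/subr0_eq.
  apply: (@pow2_small_eq0 _ _ (2 * (`|a *: x + y| + `|a| * `|x| + `|y|))).
    by rewrite mulr_ge0 // !addr_ge0 // mulr_ge0.
  move=> n; set w := a *: x + y.
  have -> : f w - (a *: f x + f y) =
      (f w - Z n w) - (a *: (f x - Z n x) + (f y - Z n y)).
    by rewrite bop_funD bop_funZ scalerBr addrACA -opprD opprB addrA subrK.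
  rewrite mulrAC; apply: le_trans (ler_normB _ _) _; rewrite !mulrDr -addrA.
  apply: lerD; first exact: fP.
  apply: le_trans (ler_normD _ _) _; apply: lerD; last exact: fP.
  by rewrite normrZ mulrCA ler_wpM2l.
have [M M0 ZM] := bop_bound (Z 0%N).
have [|L LE] := bop_ex (M := 2 + M) fl.
  move=> x; rewrite -(subrK (Z 0%N x) (f x)) mulrDl.
  apply: le_trans (ler_normD _ _) _; apply: lerD (ZM x).
  by have := fP x 0%N; rewrite expr0 mulr1.
by exists L => n x; rewrite bopBE LE.
Qed.

(* Z is the limit of the contractive iteration Z := (K + Z^2) / 2. *)
Lemma sqrt_one_sub K : K^† = K -> opbound 2^-1 K ->
  exists Z, Z^† = Z /\ (1 - Z) * (1 - Z) = 1 - K.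
Proof.
move=> KC KK; pose h : R[i] := 2^-1.
have h0 : 0 <= h by rewrite invr_ge0 ler0n.
have hN : `|h| = h by rewrite ger0_norm.
pose step S := h *: (K + S * S); pose Z n := iter n step 0.
have ZS k : Z k.+1 = h *: (K + Z k * Z k) by [].
have hh : h + h = 1 by rewrite /h; field.
have h1 : h <= 1 by rewrite -hh lerDl.
have ZC n : (Z n)^† = Z n.
  elim: n => [|n IHn]; first exact: adj0.
  by rewrite ZS adjZ adjD adjM IHn KC (geC0_conj h0).
have Zb n : opbound h (Z n).
  elim: n => [x|n IHn]; first by rewrite normr0 mulr_ge0.
  apply: (@opbound_le (`|h| * (h + h * h))).
    by rewrite hN ler_piMr // -hh lerD2l ler_piMr.
  by apply/opboundZ/opboundD => //; exact: opboundM.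
have Zd n : opbound (2^-1 ^+ n) (Z n.+1 - Z n).
  elim: n => [|n IHn].
    rewrite expr0 subr0; exact: opbound_le (Zb 1%N).
  (* A difference of squares, expanded without commutativity; as [Z n] and [Z n.+1] are bounded by
     1/2, the bound on the gap halves at each step. *)
  have -> : Z n.+2 - Z n.+1 =
      h *: (Z n.+1 * (Z n.+1 - Z n) + (Z n.+1 - Z n) * Z n).
    rewrite mulrBr mulrBl addrA subrK (ZS n.+1) [X in _ - X](ZS n) -scalerBr.
    by rewrite opprD addrACA subrr add0r.
  apply: (@opbound_le (`|h| * (h * 2^-1 ^+ n + 2^-1 ^+ n * h))).
    by rewrite hN exprS [_ * h]mulrC -mulrDl hh mul1r.
  apply/opboundZ/opboundD; exact: opboundM.
have [L LZ] := bop_limit Zd; exists L; split.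
  apply: adj_uniq => x y; apply/subr0_eq.
  apply: (@pow2_small_eq0 _ _ (4 * (`|x| * `|y|))).
    by rewrite !mulr_ge0 // ler0n.
  move=> n; have -> : '[L x, y] - '[x, L y] =
      '[(L - Z n) x, y] - '[x, (L - Z n) y].
    by rewrite !bopBE hdotBl hdotBr (adjE (Z n)) ZC opprB addrA subrK.
  have -> : 4 * (`|x| * `|y|) * 2^-1 ^+ n =
      2 * 2^-1 ^+ n * `|x| * `|y| + `|x| * (2 * 2^-1 ^+ n * `|y|) :> R[i].
    by ring.
  apply: le_trans (ler_normB _ _) _.
  by apply: lerD; apply: le_trans (CauchySchwarz_hdot _ _) _;
    rewrite ?ler_wpM2r ?ler_wpM2l //; exact: LZ.
have [M M0 LM] := bop_bound L.
suff E : L + L = K + L * L.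
  by rewrite mulrBr mulr1 mulrBl mul1r -addrA -opprD addrA E addrK.
(* In [3 + 2 * M], 2 comes from the two terms [L - Z n.+1], 1 from [Z n * (L - Z n)] and [2 * M]
   from [(L - Z n) * L]. *)
apply/subr0_eq; apply: (@opbound_pow2_eq0 _ (3 + 2 * M)).
  by rewrite addr_ge0 ?mulr_ge0 ?ler0n.
move=> n; have -> : L + L - (K + L * L) = (L - Z n.+1) + (L - Z n.+1) -
    (Z n * (L - Z n) + (L - Z n) * L).
  have ZZ : Z n.+1 + Z n.+1 = K + Z n * Z n.
    by rewrite ZS -scalerDl hh scale1r.
  rewrite [in RHS]addrACA -opprD ZZ mulrBr mulrBl.
  have -> : Z n * L - Z n * Z n + (L * L - Z n * L) = L * L - Z n * Z n.
    by rewrite addrC addrA subrK.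
  by rewrite -[RHS]addrA -opprD addrACA subrr addr0.
apply: (@opbound_le (2 * 2^-1 ^+ n.+1 + 2 * 2^-1 ^+ n.+1 +
    (h * (2 * 2^-1 ^+ n) + 2 * 2^-1 ^+ n * M))).
  rewrite le_eqVlt; apply/orP; left; apply/eqP.
  by rewrite /h exprS; field.
apply: opboundB; apply: opboundD; try exact: LZ.
  exact: opboundM.
by apply: opboundM => //; rewrite mulr_ge0 // ltW.
Qed.

(* For small c and (1 - Z)^2 = 1 - c^2 T^* T, the operators
   W+- = t s1 (1 - Z) +- c s T are isometries, and s T = (W+ - W-) / (2c). *)
Lemma bop_isometry_ind (P : bop H -> Prop) :
  (forall a S T, P S -> P T -> P (a *: S + T)) ->
  (forall W, W^† * W = 1 -> infdim [set x | W^† x = 0] -> P W) ->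
  forall T, P T.
Proof.
move=> Pl Piso; have [s1 [s2 [s11 s22 s12 s1s2]]] := shifts_ex.
have s21 : s2^† * s1 = 0 by rewrite -[LHS]adjK adjM adjK s12 adj0.
have Ps s t T : s^† * s = 1 -> t^† * t = 1 -> s^† * t = 0 -> P (s * T).
  move=> ss tt st; have ts : t^† * s = 0 by rewrite -[LHS]adjK adjM adjK st adj0.
  have [M M0 TM] := bop_bound (T^† * T).
  (* This gives [c <= 1] and [c * M <= 1/2], hence [c * c * M <= 1/2], as [sqrt_one_sub]
     requires. *)
  pose c : R[i] := (2 * (M + 1))^-1.
  have M1 : 0 < M + 1 by rewrite ltr_wpDl.
  have c0 : 0 < c by rewrite invr_gt0 mulr_gt0.
  have cT : (c *: T)^† * (c *: T) = (c * c) *: (T^† * T).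
    by rewrite adjZ -bop_scalerAr -bop_scalerAl scalerA (geC0_conj (ltW c0)).
  have cb : opbound 2^-1 ((c *: T)^† * (c *: T)).
    rewrite cT; apply: (@opbound_le (`|c * c| * M)); last exact: opboundZ.
    rewrite ger0_norm; last by rewrite mulr_ge0 // ltW.
    rewrite -mulrA -[leRHS]mul1r; apply: ler_pM; rewrite ?mulr_ge0 ?(ltW c0) //.
      by rewrite invf_le1 ?mulr_gt0 // mulr_ege1 ?ler1n // lerDr.
    rewrite /c invfM -mulrA ler_piMr ?invr_ge0 ?ler0n // mulrC.
    by rewrite ler_pdivrMr // mul1r lerDl.
  have [Z [ZC Z2]] := sqrt_one_sub (etrans (adjM _ _) (congr1 _ (adjK _))) cb.
  have Z1C : (1 - Z)^† = 1 - Z by rewrite adjB adj1 ZC.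
  pose X := s * (c *: T); pose Y := t * s1 * (1 - Z).
  have XX : X^† * X = (c *: T)^† * (c *: T).
    by rewrite /X adjM -mulrA (mulrA s^†) ss mul1r.
  have YY : Y^† * Y = 1 - (c *: T)^† * (c *: T).
    rewrite /Y !adjM Z1C -Z2 -!mulrA (mulrA t^†) tt mul1r.
    by rewrite (mulrA s1^†) s11 mul1r.
  have XY : X^† * Y = 0 by rewrite adjM /Y !mulrA -(mulrA _ s^†) st mulr0 !mul0r.
  have YX : Y^† * X = 0 by rewrite -[LHS]adjK adjM adjK XY adj0.
  have iso (l : R[i]) : `|l| = 1 -> P (l *: X + Y).
    move=> l1; apply: Piso.
      rewrite adjD adjZ mulrDl !mulrDr -!(bop_scalerAl, bop_scalerAr) XX XY YX YY.
      by rewrite !scaler0 addr0 add0r scalerA norm1_conj // scale1r addrC subrK.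
    (* The range of [t * s2] is orthogonal to those of [s] and [t * s1], which contain the ranges of
       [X] and [Y]. *)
    apply: (infdim_seq (v := fun n => t (s2 (e n)))) => [i j|n].
      by rewrite adjE -bopME tt bop1E adjE -bopME s22 bop1E e_orth.
    rewrite /mkset adjD adjZ !adjM Z1C bopDE bopZE !bopME.
    rewrite -[s^† _]bopME st -[t^† _]bopME tt bop1E -[s1^† _]bopME s12.
    by rewrite !bop0E !bop_fun0 scaler0 addr0.
  have n1 : `|-1 : R[i]| = 1 by rewrite normrN normr1.
  have P0 : P 0.
    by have := Pl (-1) _ _ (iso _ n1) (iso _ n1); rewrite scaleN1r addNr.
  have := Pl (-1) _ _ (iso _ n1) (iso _ (normr1 _)).
  have -> : -1 *: (-1 *: X + Y) + (1 *: X + Y) = (2 * c) *: (s * T).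
    rewrite !scaleN1r scale1r opprD opprK addrACA addNr addr0 /X -bop_scalerAr.
    by rewrite -scalerDl -mulr2n mulr_natl.
  move=> /(fun PX => Pl (2 * c)^-1 _ _ PX P0); rewrite addr0 scalerA mulVf.
    by rewrite scale1r.
  by rewrite mulf_neq0 ?pnatr_eq0 // gt_eqF.
(* Each half of [T = s1 s1^† T + s2 s2^† T] leaves the range of the other shift free. *)
move=> T; rewrite -[T]mul1r -s1s2 mulrDl -!mulrA -[s1 * _]scale1r.
by apply: Pl; [exact: (Ps s1 s2)|exact: (Ps s2 s1)].
Qed.

(** * Preservers *)

Definition tensor F := exists x y, F = tens x y.

(** Unless [b'] is a multiple of [b], evaluation at a vector [h] orthogonal to [b] puts [a'] on the
    line of [x], and evaluation at a vector [g] orthogonal to [b'] puts [a] there. *)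
Lemma tensor_add (a b a' b' : H) : a != 0 -> b != 0 ->
  tensor (tens a b + tens a' b') ->
  (exists c : R[i], a' = c *: a) \/ (exists c : R[i], b' = c *: b).
Proof.
move=> a0 b0 [x [y abE]].
have E h : '[h, b] *: a + '[h, b'] *: a' = '[h, y] *: x.
  exact: (congr1 (fun T : bop H => T h) abE).
pose h := '[b, b] *: b' - '[b', b] *: b.
have hb : '[h, b] = 0 by rewrite hdotBl !hdotZl mulrC subrr.
have bb0 : '[b, b] != 0 by rewrite hdot_eq0.
have [h0|h0] := eqVneq h 0.
  right; exists ('[b', b] / '[b, b]); rewrite mulrC -scalerA.
  by move/subr0_eq: h0 => <-; rewrite scalerA mulVf // scale1r.
have hb'0 : '[h, b'] != 0.
  apply: contra_neq h0 => hb'; apply: hdot0_eq0.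
  by rewrite {2}/h hdotBr !hdotZr hb hb' !mulr0 subrr.
pose g := b - ('[b, b'] / '[h, b']) *: h.
have gb : '[g, b] = '[b, b] by rewrite hdotBl hdotZl hb mulr0 subr0.
have gb' : '[g, b'] = 0 by rewrite hdotBl hdotZl divfK // subrr.
have := E g; rewrite gb gb' scale0r addr0 => ax.
have := E h; rewrite hb scale0r add0r => a'x.
have gy0 : '[g, y] != 0.
  apply: contra_neq a0 => gy; move/eqP: ax.
  by rewrite gy scale0r scaler_eq0 (negPf bb0) => /eqP.
left; exists ('[h, b']^-1 * '[h, y] * ('[g, y]^-1 * '[b, b])).
by rewrite -!scalerA ax [_ *: (_ *: x)]scalerA mulVf // scale1r -a'x scalerA
  mulVf // scale1r.
Qed.

Lemma unit_tens_scale x y : tens x y != 0 -> exists (a b : R[i]),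
  [/\ '[a *: x, a *: x] = 1, '[b *: y, b *: y] = 1 &
   tens (a *: x) (b *: y) = (a * b^*) *: tens x y].
Proof.
rewrite tens_eq0 negb_or => /andP[/normalize[a [_ ax]] /normalize[b [_ bx]]].
by exists a, b; rewrite tensZl tensZr scalerA.
Qed.

Definition unit_tensor F :=
  exists x y, [/\ '[x, x] = 1, '[y, y] = 1 & F = tens x y].

(** The condition over the unit circle encodes orthogonality of the summands through sums and
    [psummand] only, a form that a linear preserver of [psummand] respects. *)
Definition splits F := exists F1 F2, [/\ F1 != 0, F2 != 0, F = F1 + F2,
  psummand F1 & psummand F2 /\ forall l, `|l| = 1 -> psummand (F1 + l *: F2)].

Lemma unit_tensorP F :
  unit_tensor F <-> [/\ psummand F, F != 0 & ~ splits F].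
Proof.
split=> [[x [y [x1 y1 ->]]]|[Fs F0 Fi]].
  split; first exact: psummand_tens.
    by rewrite tens_eq0 negb_or !orthonormal_neq0.
  move=> [F1 [F2 [F10 F20 xyE F1s [F2s F12s]]]].
  by case: (tens_indecomposable xyE F1s F2s F12s) => /eqP; exact/negP.
by case: (psummand_split Fs F0).
Qed.

Lemma bop_isometry_unitary T : (forall x, '[T x, T x] = '[x, x]) ->
  (forall z, exists x, T x = z) -> unitary T.
Proof.
move=> Ti Ts; have TT : T^† * T = 1.
  apply: bopP => x; apply: hdot_injr => y; rewrite bopME -adjE bop1E.
  by apply: (@polarization _ _ T setT) => //; exact: bop_is_linear.
exists T^†; first exact: adjP.
split=> //; apply: bopP => z; have [x <-] := Ts z.
by rewrite bopME -[T^† (T x)]bopME TT.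
Qed.

Lemma nonparallel_ex x : x != 0 -> exists z, forall c : R[i], z != c *: x.
Proof.
move=> x0; apply: contrapT => /forallNP par.
have parE n : exists c : R[i], e n = c *: x.
  have /existsNP[c] := par (e n).
  by move=> /negP; rewrite negbK => /eqP enE; exists c.
have [c cE] := parE 0%N; have [d dE] := parE 1%N.
have c1 : '[e 0%N, e 0%N] = 1 by rewrite e_orth.
have d1 : '[e 1%N, e 1%N] = 1 by rewrite e_orth.
have /eqP : '[e 0%N, e 1%N] = 0 by rewrite e_orth.
rewrite cE dE hdotZl hdotZr !mulf_eq0 conjC_eq0 hdot_eq0 (negPf x0) orbF.
case/orP=> /eqP k0.
  by move/eqP: c1; rewrite cE k0 scale0r hdot0l eq_sym oner_eq0.
by move/eqP: d1; rewrite dE k0 scale0r hdot0l eq_sym oner_eq0.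
Qed.

(** * Action of a linear preserver on rank one operators and on isometries *)

Section Preservers.
Variable phi : {linear bop H -> bop H}.
Hypothesis phi_bij : bijective phi.
Hypothesis phi_pres : forall W : bop H, pinf W <-> pinf (phi W).

Let phi_inj : injective phi := bij_inj phi_bij.

Let phi_surj T : exists S, phi S = T.
Proof. by case: phi_bij => psi _ psiK; exists (psi T). Qed.

Let phi_eq0 T : (phi T == 0) = (T == 0).
Proof. by rewrite -{1}(linear0 phi) (inj_eq phi_inj). Qed.

Lemma psummand_pres F : psummand F <-> psummand (phi F).
Proof.
split=> [[B Bp FB]|[T Tp FT]].
  exists (phi B) => [|l l1]; first exact: (phi_pres B).1.
  by rewrite -linearZ -linearD; exact: (phi_pres _).1 (FB l l1).
have [B BE] := phi_surj T; rewrite -BE in Tp FT.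
exists B => [|l l1]; first exact: (phi_pres B).2.
by apply: (phi_pres _).2; rewrite linearD linearZ; exact: FT.
Qed.

Lemma unit_tensor_pres F : unit_tensor F <-> unit_tensor (phi F).
Proof.
have splits_pres : splits F <-> splits (phi F).
  split=> [[F1 [F2 [F10 F20 FE F1s [F2s F12s]]]]|].
    exists (phi F1), (phi F2); rewrite !phi_eq0 FE linearD.
    split; [exact: F10|exact: F20|by []|exact: (psummand_pres F1).1|].
    split=> [|l l1]; first exact: (psummand_pres F2).1.
    by rewrite -linearZ -linearD; exact: (psummand_pres _).1 (F12s l l1).
  move=> [G1 [G2 []]]; have [F1 <-] := phi_surj G1; have [F2 <-] := phi_surj G2.
  rewrite !phi_eq0 -linearD => F10 F20 /phi_inj FE F1s [F2s F12s].
  exists F1, F2.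
  split; [exact: F10|exact: F20|exact: FE|exact: (psummand_pres F1).2|].
  split=> [|l l1]; first exact: (psummand_pres F2).2.
  by apply: (psummand_pres _).2; rewrite linearD linearZ; exact: F12s.
split=> /unit_tensorP[Fs F0 Fi]; apply/unit_tensorP; split.
- exact: (psummand_pres F).1.
- by rewrite phi_eq0.
- by move/(splits_pres.2).
- exact: (psummand_pres F).2.
- by rewrite -phi_eq0.
- by move/(splits_pres.1).
Qed.

Lemma unit_tensor_scale F : tensor F -> F != 0 ->
  exists2 c : R[i], c != 0 & unit_tensor (c *: F).
Proof.
move=> [x [y ->]] xy0; have [a [b [ax by1 E]]] := unit_tens_scale xy0.
exists (a * b^*); last by exists (a *: x), (b *: y).
apply: contraTneq (orthonormal_neq0 ax) => ab0; move/eqP: E.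
by rewrite ab0 scale0r tens_eq0 (negPf (orthonormal_neq0 by1)) orbF negbK.
Qed.

Lemma tensor_pres F : tensor F <-> tensor (phi F).
Proof.
have tensorZ c T : c != 0 -> unit_tensor (c *: T) -> tensor T.
  move=> c0 [x [y [_ _ E]]]; exists (c^-1 *: x), y.
  by rewrite tensZl -E scalerA mulVf // scale1r.
have [->|F0] := eqVneq F 0.
  by split=> _; exists 0, 0; rewrite tens0l ?linear0.
split=> Ft; have [|c c0 cF] := unit_tensor_scale Ft; rewrite ?phi_eq0 //.
  by apply: (tensorZ c) => //; rewrite -linearZ; exact: (unit_tensor_pres _).1.
by apply: (tensorZ c) => //; apply: (unit_tensor_pres _).2; rewrite linearZ.
Qed.

(** If nonzero, [tens x y] can be scaled to unit vectors and is then a [psummand]; its image is a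
    rank one partial isometry, which determines the product of the norms. *)
Lemma tens_pres_norm x y (a b : H) : phi (tens x y) = tens a b ->
  '[a, a] * '[b, b] = '[x, x] * '[y, y].
Proof.
move=> xyE; have [/eqP xy0|xy0] := eqVneq (tens x y) 0.
  have := xy0; rewrite -phi_eq0 xyE tens_eq0.
  move: xy0; rewrite tens_eq0.
  by move=> /orP[]/eqP -> /orP[]/eqP ->; rewrite !hdot0l ?mul0r ?mulr0.
have [c [d [cx dy E]]] := unit_tens_scale xy0.
have cd1 : '[x, x] * '[y, y] * (c * c^* * (d * d^*)) = 1.
  move: cx dy; rewrite !hdotZl !hdotZr => cx dy.
  by rewrite -[RHS]mulr1 -{1}cx -dy; ring.
have cd0 : c * c^* * (d * d^*) != 0.
  by apply: contra_eq_neq cd1 => ->; rewrite mulr0 eq_sym oner_eq0.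
apply: (mulIf cd0); rewrite cd1.
have := @pisom_tens_norm (c *: a) (d *: b).
have -> : tens (c *: a) (d *: b) = phi (tens (c *: x) (d *: y)).
  by rewrite E linearZ xyE tensZl tensZr scalerA.
rewrite phi_eq0 tens_eq0 negb_or !orthonormal_neq0 // => /(_ _ isT).
rewrite !hdotZl !hdotZr => <-; first by ring.
exact: psummand_pisom ((psummand_pres _).1 (psummand_tens cx dy)).
Qed.

(** An isometry admits no nonzero orthogonal summand. If [phi W] killed a unit vector,
    [pinf_add_tens] would provide a summand for [phi W], whose preimage [F] would satisfy
    [W * F^† = 0], hence [F = 0]. *)
Lemma isometry_pres_inj W : W^† * W = 1 -> pinf W -> forall x, phi W x = 0 -> x = 0.
Proof.
move=> WW Wp x Wx; apply/eqP; apply: contraT => /normalize[a [_ ax]].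
have [|z z1 zP] := pinf_add_tens ((phi_pres W).1 Wp) _ ax.
  by rewrite bop_funZ Wx scaler0.
have zax : tens z (a *: x) != 0 by rewrite tens_eq0 negb_or !orthonormal_neq0.
have [F FE] := phi_surj (tens z (a *: x)).
have Fs : psummand F by apply: (psummand_pres F).2; rewrite FE; exact: psummand_tens.
have [||_ WF _] := @pisom_circle_orthogonal W F; first exact: psummand_pisom.
  by move=> l l1; apply/pinf_pisom/(phi_pres _).2; rewrite linearD linearZ /= FE; exact: zP.
case/eqP: zax; rewrite -FE -[F]adjK -[F^†]mul1r -WW -mulrA WF mulr0 adj0.
exact: linear0.
Qed.

(** [V] is [W] with its value at [y] replaced by [l *: u]. The condition on [W^† u] says that [u] is
    orthogonal to the image under [W] of the complement of [y]; it covers both [u = W y] and [u]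
    orthogonal to the range of [W]. *)
Lemma pinf_isometry_twist W y u l : W^† * W = 1 -> '[y, y] = 1 -> '[u, u] = 1 ->
  W^† u = '[u, W y] *: y -> `|l| = 1 ->
  infdim [set x | W^† x = 0 /\ '[x, u] = 0] ->
  let V := W - tens (W y) y + l *: tens u y in V^† * V = 1 /\ pinf V.
Proof.
move=> WW y1 u1 Wu l1 Wc V; pose p := tens y y; pose S := W * (1 - p).
have pC : p^† = p by rewrite adj_tens.
have VE : V = S + l *: tens u y by rewrite /V /S mulrBr mulr1 mul_tens.
have SC : S^† = (1 - p) * W^† by rewrite adjM adjB adj1 pC.
have SS : S^† * S = 1 - p.
  rewrite SC /S mulrA -(mulrA _ W^†) WW mulr1 mulrBr mulr1 mulrBl mul1r.
  by rewrite tensM y1 scale1r subrr subr0.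
have SR : S^† * tens u y = 0.
  rewrite SC mul_tens bopME Wu bop_funZ bopBE tensE bop1E y1 scale1r subrr.
  by rewrite scaler0 tens0l.
have RS : (tens u y)^† * S = 0 by rewrite -[LHS]adjK adjM adjK SR adj0.
have VV : V^† * V = 1.
  rewrite VE adjD adjZ mulrDl !mulrDr -!(bop_scalerAl, bop_scalerAr) SS SR RS.
  by rewrite !scaler0 addr0 add0r adj_tens tensM u1 scale1r scalerA
    norm1_conj // scale1r subrK.
split=> //; apply: isometry_pinf => //; apply: infdim_sub Wc => x [Wx xu].
rewrite /mkset VE adjD SC adjZ adj_tens bopDE bopME Wx bop_fun0 add0r bopZE.
by rewrite tensE xu scale0r scaler0.
Qed.


(** By [tensor_add], each image shares a factor with [tens u v]. If [x1] violated the first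
    alternative and [x2] the second, their images [tens u b] and [tens a v] would add up to rank
    two, whereas [x1 + x2] yields rank at most one. *)
Lemma tens_column_or_row x0 y0 u v : u != 0 -> v != 0 ->
  phi (tens x0 y0) = tens u v ->
  (forall x, exists u', phi (tens x y0) = tens u' v) \/
  (forall x, exists v', phi (tens x y0) = tens u v').
Proof.
move=> u0 v0 uvE.
have colrow x : (exists u', phi (tens x y0) = tens u' v) \/
    (exists v', phi (tens x y0) = tens u v').
  have [a [b abE]] : tensor (phi (tens x y0)).
    by apply: (tensor_pres _).1; exists x, y0.
  have [|[c ac]|[c bc]] := tensor_add u0 v0 (a' := a) (b' := b).
  - rewrite -uvE -abE -linearD -tensDl.
    by apply: (tensor_pres _).1; exists (x0 + x), y0.
  - by right; exists (c^* *: b); rewrite abE ac tensZl tensZr conjCK.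
  - by left; exists (c^* *: a); rewrite abE bc tensZl tensZr.
apply: contrapT => /not_orP[/existsNP[x1 x1v] /existsNP[x2 x2u]].
have [//|[b bE]] := colrow x1; have [[a aE]|//] := colrow x2.
have b0 : b != 0.
  by apply: contra_notN x1v => /eqP b0; exists 0; rewrite bE b0 tens0l tens0r.
have [|[c ac]|[c vc]] := tensor_add u0 b0 (a' := a) (b' := v).
- rewrite -bE -aE -linearD -tensDl.
  by apply: (tensor_pres _).1; exists (x1 + x2), y0.
- by case: x2u; exists (c^* *: v); rewrite aE ac tensZl tensZr conjCK.
- case: x1v; exists ((c^-1)^* *: u); rewrite bE vc tensZl tensZr.
  rewrite scalerA -rmorphM mulVf ?rmorph1 ?scale1r //.
  by apply: contra_neq v0 => c0; rewrite vc c0 scale0r.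
Qed.

(* If phi (x (x) y0) = u (x) Dx for all x, take an isometry W and change its
   value at y0: with S = W - Wy0 (x) y0, the operators S + x (x) y0 are isometries
   if x = l Wy0 or x = l z, where z is a unit vector orthogonal to the range of W.
   Orthogonality of phi(S) and u (x) Dx gives phi(S) D(Wy0) = phi(S) Dz = 0, so
   phi(S) + u (x) Dz is not injective, contradicting isometry_pres_inj. *)
Lemma no_tens_row y0 u : '[y0, y0] = 1 -> u != 0 ->
  ~ forall x, exists v', phi (tens x y0) = tens u v'.
Proof.
move=> y01 u0 row; have [s1 [s2 [s11 s22 s12 _]]] := shifts_ex.
pose q := s1 y0; pose z := s2 (e 0%N).
have q1 : '[q, q] = 1 by rewrite adjE -bopME s11.
have z1 : '[z, z] = 1 by rewrite adjE -bopME s22 e_orth.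
have s1z : s1^† z = 0 by rewrite -bopME s12.
have zq : '[z, q] = 0 by rewrite adjEr s1z hdot0l.
have s2_orth i j : '[s2 (e i), s2 (e j)] = (i == j)%:R.
  by rewrite adjE -bopME s22 e_orth.
have s1c : infdim [set x | s1^† x = 0].
  by apply: (infdim_seq s2_orth) => n; rewrite /mkset -bopME s12.
have [p' pE] := row z; have [q' qE] := row q.
pose S := s1 - tens q y0.
have zP l : `|l| = 1 -> let V := S + l *: tens z y0 in V^† * V = 1 /\ pinf V.
  move=> l1; apply: pinf_isometry_twist => //; first by rewrite s1z zq scale0r.
  apply: (infdim_seq (v := fun n => s2 (e n.+1))) => [i j|n].
    by rewrite s2_orth eqSS.
  by rewrite /mkset -bopME s12 s2_orth.
have qP l : `|l| = 1 -> let V := S + l *: tens q y0 in V^† * V = 1 /\ pinf V.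
  move=> l1; apply: pinf_isometry_twist => //.
    by rewrite -bopME s11 bop1E -/q q1 scale1r.
  apply: infdim_sub s1c => x s1x; split=> //.
  by rewrite adjEr (s1x : s1^† x = 0) hdot0l.
have kill x v' : '[x, x] = 1 -> phi (tens x y0) = tens u v' ->
    (forall l, `|l| = 1 -> pinf (S + l *: tens x y0)) -> phi S v' = 0.
  move=> x1 xE SP; have [||_ Sv _] := @pisom_circle_orthogonal (phi S) (tens u v').
  - by rewrite -xE; apply/psummand_pisom/(psummand_pres _).1/psummand_tens.
  - move=> l l1; rewrite -xE -linearZ -linearD.
    exact/pinf_pisom/(phi_pres _).1/SP.
  move/eqP: Sv; rewrite adj_tens mul_tens tens_eq0 (negPf u0) orbF.
  by move/eqP.
have Sp : phi S p' = 0 by apply: (kill z) => // l /zP[].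
have Sq : phi S q' = 0 by apply: (kill q) => // l /qP[].
(* This combination is orthogonal to [p'], so both [phi S] and [tens u p'] kill it. Injectivity
   gives [h = 0], which makes [q'] a multiple of [p'], and thus [q] a multiple of the orthogonal
   vector [z]. *)
pose h := '[p', p'] *: q' - '[q', p'] *: p'.
have hp : '[h, p'] = 0 by rewrite hdotBl !hdotZl mulrC subrr.
have [Viso Vp] := zP 1 (normr1 _).
have h0 : h = 0.
  apply: (isometry_pres_inj Viso Vp); rewrite scale1r (linearD phi) pE bopDE tensE hp.
  by rewrite scale0r addr0 bop_funB !bop_funZ Sp Sq !scaler0 subrr.
have p0 : '[p', p'] != 0.
  rewrite hdot_eq0; apply: contra_eq_neq z1 => p0; move/eqP: pE.
  rewrite p0 tens0r phi_eq0 tens_eq0 (negPf (orthonormal_neq0 y01)) orbF => /eqP ->.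
  by rewrite hdot0l eq_sym oner_eq0.
pose c := '[q', p'] / '[p', p'].
have q'E : q' = c *: p'.
  by rewrite /c mulrC -scalerA -(subr0_eq h0) scalerA mulVf // scale1r.
have : tens q y0 == tens (c^* *: z) y0.
  by rewrite -(inj_eq phi_inj) tensZl linearZ /= pE qE q'E tensZr.
rewrite -subr_eq0 -tensNl -tensDl tens_eq0 (negPf (orthonormal_neq0 y01)) orbF.
rewrite subr_eq0 => /eqP qz; move/eqP: q1.
by rewrite {1}qz hdotZl zq mulr0 eq_sym oner_eq0.
Qed.

Lemma tens_column y0 : '[y0, y0] = 1 ->
  exists2 v, '[v, v] = 1 & forall x, exists u, phi (tens x y0) = tens u v.
Proof.
move=> y01; have e0 : '[e 0%N, e 0%N] = 1 by rewrite e_orth.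
have [u [v [u1 v1 uvE]]] : unit_tensor (phi (tens (e 0%N) y0)).
  by apply: (unit_tensor_pres _).1; exists (e 0%N), y0.
have u0 := orthonormal_neq0 u1; have v0 := orthonormal_neq0 v1.
have [col|/no_tens_row[]//] := tens_column_or_row u0 v0 uvE.
by exists v.
Qed.

(** [C] is read off the images of [tens x x0] by evaluation at [v0], and [D] off those of
    [tens x0 y] by evaluating adjoints at [u0]; additivity in [x] then extends the formula to all
    [tens x y]. *)
Lemma tens_form : exists C D : bop H, [/\ unitary C, unitary D &
  forall x y, phi (tens x y) = tens (C x) (D y)].
Proof.
pose x0 := e 0%N; have x01 : '[x0, x0] = 1 by rewrite e_orth.
have [v0 v01 col] := tens_column x01.
have v00 := orthonormal_neq0 v01; have x00 := orthonormal_neq0 x01.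
have colE x : phi (tens x x0) = tens (phi (tens x x0) v0) v0.
  by have [u ->] := col x; rewrite tensE v01 scale1r.
have fi x : '[phi (tens x x0) v0, phi (tens x x0) v0] = '[x, x].
  by have := tens_pres_norm (colE x); rewrite v01 x01 !mulr1.
have fl : linear (fun x => phi (tens x x0) v0).
  by move=> a x y; rewrite tensDl tensZl linearD linearZ.
have [|C CE] := bop_ex (M := 1) fl.
  by move=> x; rewrite mul1r le_eqVlt eq_hnorm fi eqxx.
have Ci x : '[C x, C x] = '[x, x] by rewrite CE fi.
have C0 x : (C x == 0) = (x == 0) by rewrite -hdot_eq0 Ci hdot_eq0.
have {colE}colE x : phi (tens x x0) = tens (C x) v0 by rewrite CE -colE.
have left x y : exists b, phi (tens x y) = tens (C x) b.
  have [->|x_neq0] := eqVneq x 0; first by exists 0; rewrite tens0l linear0 tens0r.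
  have [->|y_neq0] := eqVneq y 0; first by exists 0; rewrite !tens0r linear0.
  have [a [b abE]] : tensor (phi (tens x y)).
    by apply: (tensor_pres _).1; exists x, y.
  have [||[c ac]|[c bc]] := @tensor_add (C x) v0 a b _ v00; first by rewrite C0.
  - rewrite -colE -abE -linearD -tensDr.
    by apply: (tensor_pres _).1; exists x, (x0 + y).
  - by exists (c^* *: b); rewrite abE ac tensZl tensZr conjCK.
  (* In the remaining case the image has right factor [v0]. Adding [tens z x0] with [z] not parallel
     to [x] keeps the image at rank at most one, so [x0] is a multiple of [y]. *)
  have [z zx] := nonparallel_ex x_neq0.
  have [|[d zd]|[d x0y]] := @tensor_add x y z x0 x_neq0 y_neq0.
  - apply: (tensor_pres _).2; exists (c^* *: a + C z), v0.
    by rewrite linearD colE abE bc tensDl tensZl tensZr.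
  - by move: (zx d); rewrite zd eqxx.
  have d0 : d != 0 by apply: contra_neq x00 => d0; rewrite x0y d0 scale0r.
  exists (d^-1 *: v0); rewrite tensZr -colE x0y tensZr linearZ /= scalerA.
  by rewrite -rmorphM mulVf // rmorph1 scale1r.
pose u0 := C x0; have u01 : '[u0, u0] = 1 by rewrite Ci.
have rowE y : phi (tens x0 y) = tens u0 ((phi (tens x0 y))^† u0).
  by have [b ->] := left x0 y; rewrite adj_tens tensE u01 scale1r.
have gi y : '[(phi (tens x0 y))^† u0, (phi (tens x0 y))^† u0] = '[y, y].
  by have := tens_pres_norm (rowE y); rewrite u01 x01 !mul1r.
have gl : linear (fun y => (phi (tens x0 y))^† u0).
  move=> a x y; rewrite tensDr tensZr linearD linearZ /= adjD adjZ.
  by rewrite bopDE bopZE conjCK.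
have [|D DE] := bop_ex (M := 1) gl.
  by move=> x; rewrite mul1r le_eqVlt eq_hnorm gi eqxx.
have {}rowE y : phi (tens x0 y) = tens u0 (D y) by rewrite DE -rowE.
have Di x : '[D x, D x] = '[x, x] by rewrite DE gi.
have formE x y : phi (tens x y) = tens (C x) (D y).
  have [[c xc]|x_npar] := pselect (exists c : R[i], x = c *: x0).
    by rewrite xc tensZl linearZ /= rowE bop_funZ tensZl.
  have [b bE] := left x y; have [b' b'E] := left (x + x0) y.
  (* Comparison at [x + x0]: unless [b = b'], [C x] is a multiple of [u0 = C x0], and so is [x] of
     [x0]. *)
  have E : tens (C x) (b - b') = tens u0 (b' - D y).
    move: b'E; rewrite tensDl linearD /= bE rowE bop_funD tensDl -/u0.
    move/(canRL (addrK _)) => bE'.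
    by rewrite !tensDr !tensNr bE' -!addrA addrC -!addrA addNr addr0.
  have [bb'|bb'] := eqVneq (b - b') 0.
    move/eqP: E; rewrite bb' tens0r eq_sym tens_eq0 (negPf (orthonormal_neq0 u01)) /=.
    by rewrite subr_eq0 bE (subr0_eq bb') => /eqP ->.
  case: x_npar; have := congr1 (fun T : bop H => T (b - b')) E.
  rewrite !tensE => Ecx; exists ('[b - b', b - b']^-1 * '[b - b', b' - D y]).
  apply/eqP; rewrite -subr_eq0 -C0 bop_funB bop_funZ -scalerA -/u0 -Ecx scalerA.
  by rewrite mulVf ?hdot_eq0 // scale1r subrr.
(* For surjectivity, the preimages of [tens z v0] and [tens u0 z] have rank at most one, and their
   factors supply preimages of [z]. *)
exists C, D; split=> //; apply: bop_isometry_unitary => // z.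
- have [->|z0] := eqVneq z 0; first by exists 0; rewrite bop_fun0.
  have [T TE] := phi_surj (tens z v0).
  have [x [y xyE]] : tensor T by apply: (tensor_pres _).2; rewrite TE; exists z, v0.
  exists ('[v0, D y] *: x); rewrite bop_funZ -tensE -formE -xyE TE tensE.
  by rewrite v01 scale1r.
- have [T TE] := phi_surj (tens u0 z).
  have [x [y xyE]] : tensor T by apply: (tensor_pres _).2; rewrite TE; exists u0, z.
  exists ('[u0, C x] *: y); rewrite bop_funZ -tensE -adj_tens -formE -xyE TE.
  by rewrite adj_tens tensE u01 scale1r.
Qed.

(** The value of [W] at a unit vector [y] can be rotated within the class, so
    [phi (W - tens (W y) y)] is orthogonal to [tens (C (W y)) (D y)] and hence kills [D y]. *)
Lemma isometry_form (C D W : bop H) : (forall x, '[C x, C x] = '[x, x]) ->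
  (forall x, '[D x, D x] = '[x, x]) ->
  (forall x y, phi (tens x y) = tens (C x) (D y)) ->
  W^† * W = 1 -> infdim [set x | W^† x = 0] -> phi W * D = C * W.
Proof.
move=> C_iso D_iso phi_tens WW Wc; apply: bopP => y; have [->|y0] := eqVneq y 0.
  by rewrite !bop_fun0.
have [a [a0 ay1]] := normalize y0.
apply: (scalerI a0); rewrite -!bop_funZ; move: (a *: y) ay1 => {y0 a0}y y1.
have Wy1 : '[W y, W y] = 1 by rewrite adjE -bopME WW.
have [||_ A0 _] := @pisom_circle_orthogonal (phi (W - tens (W y) y))
    (tens (C (W y)) (D y)).
- by apply: pisom_tens; rewrite C_iso D_iso y1 Wy1 mulr1.
- move=> l l1; rewrite -phi_tens -linearZ -linearD.
  apply/pinf_pisom/(phi_pres _).1.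
  have [||_ //] := @pinf_isometry_twist W y (W y) l WW y1 Wy1 _ l1.
    by rewrite Wy1 scale1r -bopME WW.
  apply: infdim_sub Wc => x Wx; split=> //.
  by rewrite adjEr (Wx : W^† x = 0) hdot0l.
move/eqP: A0; rewrite adj_tens mul_tens tens_eq0 orbC.
rewrite -hdot_eq0 C_iso Wy1 oner_eq0 /= linearB phi_tens bopBE tensE D_iso y1.
by rewrite scale1r subr_eq0 => /eqP.
Qed.

End Preservers.

End SeparableHilbertSpace.

Theorem theorem1 (R : realType) (H : hilbertType R)
    (H_separable : separable H)
    (H_infinite : infinite_hilbert_dim [set: H])
    (e : nat -> H) (e_complete : complete_orthonormal_seq e)
    (phi : {linear bop H -> bop H}) (phi_bij : bijective phi)
    (phi_pres : forall W : bop H,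
      infinite_partial_isometry W <-> infinite_partial_isometry (phi W)) :
  exists U V : bop H, [/\ unitary U, unitary V &
    (forall T : bop H, phi T = U * T * V) \/
    (forall T : bop H, exists2 Ttr : bop H,
       is_transpose e T Ttr & phi T = U * Ttr * V)].
Proof.
have [C [D [Cu Du phi_tens]]] := tens_form e_complete phi_bij phi_pres.
have unitary_iso (U : bop H) : unitary U -> forall x, '[U x, U x] = '[x, x].
  by move=> [S US [SU _]] x; rewrite US -bopME SU.
have [D' DD' [D'D D_D']] := Du.
(* [V] is the adjoint [D'] of [D], which turns [phi W * D = C * W] into [phi W = C * W * D']. *)
exists C, D'; split=> //.
  by exists D => // x y; rewrite hdotC -DD' -hdotC.
(* The first formula holds on a linear space of operators that contains the isometries of infinite
   corank, and these span everything. *)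
left; apply: (bop_isometry_ind e_complete) => [a S T ST TT|W WW Wc].
  rewrite linearP ST TT mulrDr mulrDl -bop_scalerAr -bop_scalerAl //.
have <- := isometry_form e_complete phi_pres (unitary_iso _ Cu)
  (unitary_iso _ Du) phi_tens WW Wc.
by rewrite -mulrA D_D' mulr1.
Qed.
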